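(* Let $T$ be an $m$-uniform hypertree with $k$ edges and diameter $d$ such that $(k-d-6)(m-1)\ge 42$. If $T\ne T_d(c_{p+1}=k-d)$, where $p=\lfloor d/2\rfloor$, then $\lambda_1(T)\le \lambda_1(T_d(c_p=k-d))$, and equality holds only when $T=T_d(c_p=k-d)$.
   Context: A hypergraph has a finite vertex set and an edge set of non-empty subsets of the vertex set; it is $m$-uniform if all edges have cardinality $m$ (with $m\ge 2$), and linear if two distinct edges share at most one vertex. The adjacency matrix of a linear $m$-uniform hypergraph $\mathcal{H}$ has $(i,j)$ entry $\frac{1}{m-1}$ if $i\ne j$ lie in a common edge, and $0$ otherwise; $\lambda_1(\mathcal{H})$ denotes its spectral radius. The degree of a vertex is the corresponding row sum of the adjacency matrix, that is, the number of edges containing it; a vertex is pendant if its degree is one and non-pendant if its degree is larger. A loose path of length $d$, $P_L(d)=v_1e_1v_2e_2\dots v_de_dv_{d+1}$, is the $m$-uniform hypergraph with edges $e_1,\dots,e_d$ such that $e_{i-1}\cap e_i=\{v_i\}$ for $2\le i\le d$ (the $v_i$ distinct), non-consecutive edges are disjoint, and $v_1\in e_1$, $v_{d+1}\in e_d$ are pendant. A loose cycle of length $l\ge3$, $v_1e_1v_2e_2\dots v_le_lv_1$, is the $m$-uniform hypergraph with edges $e_1,\dots,e_l$ in which $e_{i-1}\cap e_i=\{v_i\}$ (indices mod $l$, the $v_i$ distinct) and edges that are not cyclically consecutive are disjoint. A hypertree is a connected linear hypergraph containing no loose cycle in which every edge contains at most two non-pendant vertices. The diameter is the maximum distance between two vertices,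 distance being the minimum length (number of edges) of a path joining them. Attaching a pendant edge at a vertex $v$ means adding a new edge consisting of $v$ and $m-1$ new vertices. $T_d(c_2,\dots,c_d)$ is the hypertree obtained from $P_L(d)=v_1e_1v_2\dots v_de_dv_{d+1}$ by attaching $c_i$ pendant edges at $v_i$ for $i=2,\dots,d$; when only some of the $c_i$ are listed, the others are $0$. Equality of hypergraphs means isomorphism.
   Formalization: The formal theorem assumes p = floor(d/2) ≥ 2 (d ≥ 4), since T_d(c_p = k-d) is only defined for 2 ≤ p ≤ d; for d = 3 it is undefined, and attaching at v_1 instead makes the claim false (m = 2, k = 51); d = 2 leaves only the excluded hypertree. *)

(* Defs.v *)
From HB Require Import structures.
From mathcomp Require Import classical_sets reals complex.
(* After [classical_sets], so that [set0] and the like are those of [finset]. *)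
From mathcomp Require Import all_boot all_order all_algebra.

Set Implicit Arguments.
Unset Strict Implicit.
Unset Printing Implicit Defensive.

Import GRing.Theory.

Record hypergraph := Hypergraph {
  vertex :> finType;
  edges : {set {set vertex}};
  edges_nonempty : set0 \notin edges }.

Definition isomorphic (G H : hypergraph) : Prop :=
  exists2 f : G -> H, bijective f &
    forall e : {set G}, (f @: e \in edges H) = (e \in edges G).

Section HypergraphTheory.
Variable H : hypergraph.

Definition uniform (m : nat) : Prop := forall e : {set H}, e \in edges H -> #|e| = m.

Definition linear_hypergraph : Prop :=
  forall e f : {set H}, e \in edges H -> f \in edges H -> e != f -> #|e :&: f| <= 1.

Definition degree (v : H) : nat := #|[set e in edges H | v \in e]|.

Definition non_pendant (v : H) : bool := 1 < degree v.

(* A path of length [n] from [x] to [y]: an alternating sequence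
   [v_0 e_0 v_1 ... e_(n-1) v_n] of distinct vertices and distinct edges.
   The shortest ones are exactly the shortest loose paths from [x] to [y]. *)
Definition path_of_length (x y : H) (n : nat) : Prop :=
  exists (v : 'I_n.+1 -> H) (e : 'I_n -> {set H}),
    [/\ injective v, injective e, v ord0 = x, v ord_max = y &
        forall i : 'I_n, [/\ e i \in edges H,
          v (widen_ord (leqnSn n) i) \in e i & v (lift ord0 i) \in e i]].

Definition connected_hypergraph : Prop :=
  forall x y : H, exists n, path_of_length x y n.

Definition distance_is (x y : H) (n : nat) : Prop :=
  path_of_length x y n /\ forall j, path_of_length x y j -> n <= j.

Definition diameter_is (d : nat) : Prop :=
  (exists x y : H, distance_is x y d) /\
  (forall (x y : H) n, distance_is x y n -> n <= d).

(* Indices are cyclic: [ordS] and [ord_pred] are successor and predecessor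
   modulo [l]. *)
Definition loose_cycle (l : nat) (v : 'I_l -> H) (e : 'I_l -> {set H}) : Prop :=
  [/\ 3 <= l, injective v, forall i, e i \in edges H,
      forall i, e (ord_pred i) :&: e i = [set v i] &
      forall i j : 'I_l, j != i -> j != ordS i -> i != ordS j ->
        [disjoint e i & e j]].

Definition hypertree : Prop :=
  [/\ connected_hypergraph, linear_hypergraph,
      ~ (exists (l : nat) (v : 'I_l -> H) (e : 'I_l -> {set H}),
           loose_cycle v e) &
      forall e : {set H}, e \in edges H ->
        #|[set v in e | non_pendant v]| <= 2].

End HypergraphTheory.

Section SpectralRadius.
Local Open Scope ring_scope.
Local Open Scope classical_set_scope.
Variable R : realType.

Definition adjacency_matrix (m : nat) (H : hypergraph) : 'M[R]_#|H| :=
  \matrix_(i, j)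
    if (i != j) &&
       [exists e in edges H, (enum_val i \in e) && (enum_val j \in e)]
    then (m.-1)%:R^-1 else 0.

(* The largest modulus of a complex eigenvalue; for [0 < n] the set below is
   finite and non-empty, so its supremum is a maximum. *)
Definition spectral_radius (n : nat) (A : 'M[R]_n) : R :=
  sup [set r : R | exists2 z : R[i],
         eigenvalue (map_mx (real_complex R) A) z & `|z| = real_complex R r].

Definition lambda1 (m : nat) (H : hypergraph) : R :=
  spectral_radius (adjacency_matrix m H).

End SpectralRadius.

Section LoosePath.
Variables m d : nat.

(* [inl i] is the vertex v_(i+1) and [inr (j, a)], for [a < m - 2], is the
   [a]-th remaining vertex of the edge e_(j+1). *)
Definition loose_path_vertex : finType := ('I_d.+1 + 'I_d * 'I_(m - 2))%type.

Definition loose_path_edge (j : 'I_d) : {set loose_path_vertex} :=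
  [set inl (widen_ord (leqnSn d) j); inl (lift ord0 j)]
  :|: [set inr (j, a) | a : 'I_(m - 2)].

Definition loose_path_edges : {set {set loose_path_vertex}} :=
  [set loose_path_edge j | j : 'I_d].

Lemma loose_path_edges_nonempty : set0 \notin loose_path_edges.
Proof.
apply/imsetP => -[j _ /setP/(_ (inl (widen_ord (leqnSn d) j)))].
by rewrite !inE eqxx.
Qed.

Definition loose_path : hypergraph := Hypergraph loose_path_edges_nonempty.

End LoosePath.

Section Attach.
Variables (m : nat) (H : hypergraph) (c : H -> nat).

(* [c v] pendant edges are attached at each vertex [v]; [inr (Tagged _ j, a)],
   with [j : 'I_(c v)], is the [a]-th of the [m - 1] new vertices of the
   [j]-th edge attached at [v]. *)
Definition attach_index : finType := {v : H & 'I_(c v)}.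

Definition attach_vertex : finType := (H + attach_index * 'I_(m - 1))%type.

Definition attached_edge (s : attach_index) : {set attach_vertex} :=
  inl (tag s) |: [set inr (s, a) | a : 'I_(m - 1)].

Definition attach_edges : {set {set attach_vertex}} :=
  [set inl @: e | e : {set H} in edges H]
  :|: [set attached_edge s | s : attach_index].

Lemma attach_edges_nonempty : set0 \notin attach_edges.
Proof.
apply/setUP => -[/imsetP[e eH] | /imsetP[s _ /setP/(_ (inl (tag s)))]].
  move/esym/eqP; rewrite imset_eq0 => /eqP e0.
  by move: eH; rewrite e0 (negPf (edges_nonempty H)).
by rewrite !inE eqxx.
Qed.

Definition attach_pendant_edges : hypergraph :=
  Hypergraph attach_edges_nonempty.

End Attach.

(* T_d(c_2, ..., c_d); the values of [c] outside 2, ..., d are not used. *)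
Definition Td (m d : nat) (c : nat -> nat) : hypergraph :=
  @attach_pendant_edges m (loose_path m d) (fun x =>
    match x with
    | inl i => if 2 <= i.+1 <= d then c i.+1 else 0
    | inr _ => 0
    end).

Definition Td_single (m d i n : nat) : hypergraph :=
  Td m d (fun j => if j == i then n else 0).

(* Main.v *)
(* Write [M = m - 1], [n = k - d] and [q + M - 1 = M * lambda].
   If no vertex of [T] has degree [n + 2], root [T] at a vertex of maximal degree
   and give every edge its own positive weights on its vertices; by AM-GM the
   spectral radius is at most the largest total weight ratio met at a vertex, and
   no compatibility between the weights of different edges is needed. At the root
   [q] of [q (q + M - 1) = (n + 2) M], which the numerical hypothesis makes at
   least 7, weights decreasing geometrically away from the root give
   [lambda_1(T) <= (q + M - 1) / M], the value of a star with [n + 2] edges.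
   Otherwise all edges outside a diametral path meet at one vertex of it, so [T]
   is some [T_d(c_i = n)]. These have explicit positive eigenfunctions: along each
   of the two arms the values obey a linear recurrence, and the equation at the
   hub involves the ratio of consecutive values at the end of each arm. That ratio
   is strictly concave in the length of the arm, so moving the hub towards the
   middle increases [q], and every such [q] exceeds that of the star. *)
Require Import Defs.
From HB Require Import structures.
From mathcomp Require Import classical_sets reals complex.
From mathcomp Require Import topology normedtype.
From mathcomp Require Import all_boot all_order all_algebra.
From mathcomp Require Import reals.
From mathcomp Require Import zify ring lra.

Set Implicit Arguments.
Unset Strict Implicit.
Unset Printing Implicit Defensive.

Import Order.TTheory GRing.Theory Num.Theory.
Import numFieldNormedType.Exports.

(** * Loose cycles and orientations *)

Section Walks.
Variable T : hypergraph.
Implicit Types (F : {set {set T}}) (e f g : {set T}).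

Definition acyclic : Prop :=
  ~ (exists (l : nat) (v : 'I_l -> T) (e : 'I_l -> {set T}), loose_cycle v e).

Definition linked F : rel T :=
  fun u w => [exists e in F, (u \in e) && (w \in e)].

Lemma linked_sym F : symmetric (linked F).
Proof. by move=> u w; apply: eq_existsb => e; rewrite [(u \in e) && _]andbC. Qed.

Lemma linear_inter e f (x : T) : linear_hypergraph T ->
  e \in edges T -> f \in edges T -> e != f -> x \in e -> x \in f ->
  e :&: f = [set x].
Proof.
move=> lin eE fE ef xe xf; apply/eqP; rewrite eq_sym eqEcard cards1 lin // andbT.
by rewrite sub1set inE xe xf.
Qed.

(* A shortest walk in [F] between two vertices of [f] closes up with [f] to a
   loose cycle, since any failure of looseness is a shortcut. *)
Lemma walk_chord F f : linear_hypergraph T -> acyclic ->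
  F \subset edges T -> f \in edges T -> f \notin F ->
  forall l (u : nat -> T), (forall i, i < l -> linked F (u i) (u i.+1)) ->
  u 0 \in f -> u l \in f -> u 0 = u l.
Proof.
move=> lin acyc FE fE fF; elim/ltn_ind => l IH u uw u0f ulf.
have [//|/eqP u0l] := u 0 =P u l; exfalso.
have short l' (u' : nat -> T) : l' < l ->
    (forall i, i < l' -> linked F (u' i) (u' i.+1)) ->
    u' 0 \in f -> u' l' \in f -> u' 0 != u' l' -> False.
  by move=> l'l w' a b; rewrite (IH l' l'l u' w' a b) eqxx.
have shortcut i j : i.+1 < j -> j <= l -> linked F (u i) (u j) -> False.
  move=> ij jl lij.
  (* The new walk jumps from [u i] directly to [u j]. *)
  apply: (short (l - (j - i.+1)) (fun t => if t <= i then u t else u (t + (j - i.+1)))).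
  - lia.
  - move=> t tl /=; case: (ltngtP t i) => ti; [apply: uw; lia| |].
      have -> : t.+1 + (j - i.+1) = (t + (j - i.+1)).+1 by lia.
      by apply: uw; lia.
    by rewrite ti; have -> : i.+1 + (j - i.+1) = j by lia.
  - by [].
  - case: ifP => h; last by have -> : l - (j - i.+1) + (j - i.+1) = l by lia.
    by exfalso; lia.
  - rewrite /=; case: ifP => h; first by exfalso; lia.
    by have -> : l - (j - i.+1) + (j - i.+1) = l by lia.
(* A repeated vertex shortens the walk: if it recurs at the end, the walk is cut after [u i];
   otherwise [u i] is linked to [u j.+1]. *)
have uinj i j : i < j -> j <= l -> u i = u j -> False.
  move=> ij; rewrite leq_eqVlt => /orP[/eqP jl|jl] uij.
    have i0 : i != 0 by apply: contraNneq u0l => i0; rewrite -jl -uij i0.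
    apply: (short i u); rewrite ?uij ?jl // -?jl // => t ti.
    by apply: uw; lia.
  by apply: (shortcut i j.+1) => //; rewrite uij uw.
pose g i := odflt set0 [pick e in F | (u i \in e) && (u i.+1 \in e)].
have gP i : i < l -> [/\ g i \in F, u i \in g i & u i.+1 \in g i].
  move=> /uw /exists_inP[e eF ue]; rewrite /g.
  by case: pickP => [e' /and3P[]//|/(_ e)]; rewrite eF ue.
have gE i : i < l -> g i \in edges T by move=> /gP[/(subsetP FE)].
have gf i : i < l -> g i != f.
  by move=> /gP[gF _ _]; apply: contraNneq fF => <-.
have linkg i x y : i < l -> x \in g i -> y \in g i -> linked F x y.
  by move=> /gP[gF _ _] xg yg; apply/exists_inP; exists (g i); rewrite ?xg.
have gg i : i.+1 < l -> g i != g i.+1.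
  move=> il; apply/eqP => gi; apply: (shortcut i i.+2) => //.
  have [_ a _] := gP i (ltnW il); have [_ _ b] := gP _ il.
  by apply: (linkg i) => //; rewrite ?gi //; exact: ltnW.
(* A vertex common to two non-consecutive edges replaces the stretch of the walk between them. *)
have gdisj i j x : i.+1 < j -> j < l -> x \in g i -> x \in g j -> False.
  move=> ij jl xi xj.
  apply: (short (l - (j - i.+1)) (fun t => if t <= i then u t else
            if t == i.+1 then x else u (t + (j - i.+1)))).
  - lia.
  - move=> t tl /=; case: (ltngtP t i) => ti.
    + by apply: uw; lia.
    + have -> : (t.+1 == i.+1) = false by apply/negbTE; lia.
      case: eqP => [ti1|_].
        have -> : t.+1 + (j - i.+1) = j.+1 by lia.
        by have [_ _ ?] := gP j jl; exact: (linkg j).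
      have -> : t.+1 + (j - i.+1) = (t + (j - i.+1)).+1 by lia.
      by apply: uw; lia.
    + rewrite ti eqxx; have il : i < l by lia.
      by have [_ ? _] := gP i il; exact: (linkg i).
  - by [].
  - rewrite !ifF; [|apply/negbTE; lia|apply/negbTE; lia].
    by have -> : l - (j - i.+1) + (j - i.+1) = l by lia.
  - rewrite /= !ifF; [|apply/negbTE; lia|apply/negbTE; lia].
    by have -> : l - (j - i.+1) + (j - i.+1) = l by lia.
(* A vertex [x] of [f] on an inner edge is either [u 0], which gives a shortcut to [u i.+1], or the
   end of a shorter walk. *)
have fdisj i x : 0 < i -> i.+1 < l -> x \in f -> x \in g i -> False.
  move=> i0 il xf xi; have il' := ltnW il.
  have [x0|x0] := eqVneq x (u 0).
    apply: (shortcut 0 i.+1) => //; rewrite -x0.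
    by have [_ _ ?] := gP i il'; exact: (linkg i).
  apply: (short i.+1 (fun t => if t <= i then u t else x)) => //=.
  - move=> t; rewrite ltnS => ti; rewrite ti; case: ifP => [ti'|ti'].
      by apply: uw; lia.
    have -> : t = i by lia.
    by have [_ ? _] := gP i il'; exact: (linkg i).
  - by rewrite ltnn.
  - by rewrite ltnn eq_sym.
have l2 : 1 < l.
  case: (l) u0l ulf gP gf gE => [|[|//]]; first by rewrite eqxx.
  move=> u01 u1f gP' gf' gE'; exfalso.
  have [gF a b] := gP' 0 isT.
  have := linear_inter lin (gE' 0 isT) fE (gf' 0 isT) a u0f.
  by move/setP/(_ (u 1)); rewrite !inE b u1f eq_sym (negbTE u01).
(* The cycle runs through [f], [g 0], ..., [g l.-1], and [u l] joins the last edge to [f]; hence the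
   shift by one in both families. *)
apply: acyc; exists l.+1,
  (fun i : 'I_l.+1 => if val i is i'.+1 then u i' else u l),
  (fun i : 'I_l.+1 => if val i is i'.+1 then g i' else f); split=> //.
- move=> [[|i] il] [[|j] jl] /= uij; apply: val_inj => //=.
  + by exfalso; apply: (uinj j l).
  + by exfalso; apply: (uinj i l).
  + case: (ltngtP i j) => [ij|ij|->] //; exfalso.
      by apply: (uinj i j) => //; rewrite ltnW.
    by apply: (uinj j i) => //; rewrite ltnW.
- by case=> [[|i] il] //=; apply: gE.
- case=> [[|i] il] /=.
    rewrite modn_small; last lia.
    case: l l2 {IH short shortcut uinj gdisj fdisj} uw ulf u0l gP gE gf linkg gg il => // l l2 uw ulf u0l gP gE gf linkg gg il.
    have [_ _ ?] := gP l (ltnSn l).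
    by apply: linear_inter; rewrite ?gE ?gf.
  rewrite modnDr modn_small; last lia.
  have il' : i < l by [].
  have [_ a b] := gP i il'; case: i il il' a b => [|i] il il' a b.
    by apply: linear_inter; rewrite ?gE // eq_sym gf.
  have [_ c d] := gP i (ltnW il').
  by apply: linear_inter; rewrite ?gE ?gg // ltnW.
- move=> [[|i] il] [[|j] jl] //=; rewrite -!val_eqE /= => ne1 ne2 ne3.
  + apply/pred0P => x /=; apply/negbTE/negP => /andP[xf xg].
    have jl1 : j.+1 < l.
      rewrite ltn_neqAle; apply/andP; split; last by [].
      by apply: contraNneq ne3 => ->; rewrite modnn.
    apply: (fdisj j x) => //; rewrite lt0n.
    by apply: contraNneq ne2 => ->; rewrite modn_small //; lia.
  + apply/pred0P => x /=; apply/negbTE/negP => /andP[xg xf].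
    have jl1 : i.+1 < l.
      rewrite ltn_neqAle; apply/andP; split; last by [].
      by apply: contraNneq ne2 => ->; rewrite modnn.
    apply: (fdisj i x) => //; rewrite lt0n.
    by apply: contraNneq ne3 => ->; rewrite modn_small //; lia.
  + apply/pred0P => x /=; apply/negbTE/negP => /andP[xi xj].
    case: (ltngtP i j) => ij.
    * apply: (gdisj i j x) => //; rewrite ltn_neqAle ij andbT.
      by apply: contraNneq ne2 => ->; rewrite modn_small.
    * apply: (gdisj j i x) => //; rewrite ltn_neqAle ij andbT.
      by apply: contraNneq ne3 => ->; rewrite modn_small.
    * by rewrite ij eqxx in ne1.
Qed.
End Walks.

Section Orientation.
Variable T : hypergraph.
Implicit Types (F : {set {set T}}) (e f g : {set T}).

(* [top e] is the vertex of [e] closest to the root [h], [par u] the edge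
   joining [u] to its parent and [dep u] the distance from [h] to [u]. *)
Record oriented (h : T) F (top : {set T} -> T) (par : T -> {set T})
    (dep : T -> nat) : Prop := Oriented {
  top_in : forall e, e \in F -> top e \in e;
  par_of : forall e u, e \in F -> u \in e -> u != top e ->
    [/\ par u = e, dep u = (dep (top e)).+1 & u != h];
  top_par : forall e, e \in F -> top e != h ->
    [/\ par (top e) \in F, top e \in par (top e) &
        top e != top (par (top e))];
  dep_root : dep h = 0 }.

(** Some step of the path leaves [S]; its edge meets [S] without lying inside it, which no edge of
    [F] does. *)
Lemma path_of_length_exit (h x : T) n (S : {set T}) F :
  path_of_length h x n -> h \in S ->
  (forall e, e \in F -> e :&: S != set0 -> e \subset S) ->
  x \notin S -> exists2 e, e \in edges T & (e :&: S != set0) && (e \notin F).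
Proof.
case=> [v [e [_ _ v0 vn ve]]] hS FS xS.
have [i iS|noexit] := pickP [pred i : 'I_n |
    (v (widen_ord (leqnSn n) i) \in S) && (v (lift ord0 i) \notin S)].
  case/andP: iS => vi vi1; have [eE ei ei1] := ve i.
  have eS : e i :&: S != set0.
    by apply/set0Pn; exists (v (widen_ord (leqnSn n) i)); rewrite inE ei.
  exists (e i); rewrite // eS; apply: contra vi1 => eF.
  exact: (subsetP (FS _ eF eS)).
suff vS j (jn : j < n.+1) : v (Ordinal jn) \in S.
  by move: xS; rewrite -vn -[ord_max]/(Ordinal (ltnSn n)) vS.
elim: j jn => [|j IHj] jn.
  by rewrite (_ : Ordinal jn = ord0) ?v0 //; apply: val_inj.
have jn' : j < n by [].
have := noexit (Ordinal jn'); rewrite inE /=.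
rewrite (_ : widen_ord _ _ = Ordinal (ltnW jn)); last exact: val_inj.
rewrite IHj /= => /negbT; rewrite negbK.
by rewrite (_ : lift _ _ = Ordinal jn) //; apply: val_inj.
Qed.

Lemma linkedS F F' u w : F \subset F' -> linked F u w -> linked F' u w.
Proof.
move=> FF' /exists_inP[e eF ue]; apply/exists_inP; exists e => //.
exact: (subsetP FF').
Qed.

Lemma connect_linkedS F F' u w :
  F \subset F' -> connect (linked F) u w -> connect (linked F') u w.
Proof.
move=> FF'; apply: connect_sub => x y xy; apply: connect1.
exact: linkedS xy.
Qed.

Lemma connect_chord F f a b : linear_hypergraph T -> acyclic T ->
  F \subset edges T -> f \in edges T -> f \notin F ->
  a \in f -> b \in f -> connect (linked F) a b -> a = b.
Proof.
move=> lin acyc FE fE fF af bf /connectP[p pp pb].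
have := @walk_chord T F f lin acyc FE fE fF (size p) (fun i => nth a (a :: p) i).
move=> /(_ _ af); rewrite /= -last_nth -pb => ->//.
by move=> i ip; apply/(pathP a).
Qed.

(** Edges are added one at a time, keeping the covered part connected to [h]. Connectedness yields a
    new edge meeting the covered part, and by [connect_chord] it does so in a single vertex, which
    becomes its top. *)
Lemma exists_oriented (h : T) : connected_hypergraph T ->
  linear_hypergraph T -> acyclic T ->
  exists top par dep, oriented h (edges T) top par dep.
Proof.
move=> conn lin acyc.
suff /(_ _ (leqnn #|edges T|)) [F [FE cF [top [par [dep [oF _]]]]]] :
    forall j, j <= #|edges T| -> exists F, [/\ F \subset edges T, #|F| = j &
      exists top par dep, oriented h F top par dep /\
        forall u, u \in h |: cover F -> connect (linked F) h u].
  have -> : edges T = F by apply/eqP; rewrite eq_sym eqEcard FE cF leqnn.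
  by exists top, par, dep.
elim=> [_|j IHj jE].
  exists set0; rewrite sub0set cards0; split=> //.
  exists (fun=> h), (fun=> set0), (fun=> 0); split.
    by split=> // ? ; rewrite inE.
  by move=> u; rewrite /cover big_set0 setU0 inE => /eqP->.
have [F [FE cF [top [par [dep [oF cn]]]]]] := IHj (ltnW jE).
set S := h |: cover F in cn.
have FS e : e \in F -> e \subset S.
  move=> eF; apply: subset_trans (subsetUr _ _).
  exact: (bigcup_sup e).
(* An edge outside [F] may miss [S]; then a path from [h] to one of its vertices leaves [S] through
   a suitable edge. *)
have [f fE /andP[fS fF]] : exists2 f, f \in edges T & (f :&: S != set0) && (f \notin F).
  have /subsetPn[e eE eF] : ~~ (edges T \subset F).
    by apply: contraL jE => /subset_leq_card; rewrite cF -leqNgt.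
  have /set0Pn[x xe] : e != set0.
    by apply: contraNneq (edges_nonempty T) => <-.
  have [xS|xS] := boolP (x \in S).
    by exists e; rewrite // eF andbT; apply/set0Pn; exists x; rewrite inE xe.
  have [n hx] := conn h x.
  by apply: path_of_length_exit hx _ _ xS; rewrite ?inE ?eqxx // => e' /FS.
case/set0Pn: fS => r /setIP[rf rS].
have fr u : u \in f -> u != r -> u \notin S.
  move=> uf; apply: contraNN => uS; apply/eqP.
  apply: (@connect_chord F f) => //; apply: connect_trans (cn r rS).
  by rewrite (sym_connect_sym (@linked_sym _ F)) cn.
have inS e u : e \in F -> u \in e -> u \in S by move=> /FS /subsetP; apply.
pose new u := (u \in f) && (u != r).
have newS u : u \in S -> new u = false.
  move=> uS; apply/negbTE/negP => /andP[uf ur].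
  by have := fr u uf ur; rewrite uS.
have hS : h \in S by rewrite !inE eqxx.
have Ff e : e \in F -> (e == f) = false.
  by move=> eF; apply: contraNF fF => /eqP<-.
exists (f |: F); split.
- by rewrite subUset sub1set fE.
- by rewrite cardsU1 fF cF.
exists (fun e => if e == f then r else top e),
  (fun u => if new u then f else par u),
  (fun u => if new u then (dep r).+1 else dep u); split.
  have [tin pof tpar dr] := oF.
  split=> [e|e u|e|]; last by rewrite newS.
  - by rewrite 2!inE => /orP[/eqP->|eF]; rewrite ?eqxx // Ff ?tin.
  - rewrite 2!inE => /orP[/eqP->|eF].
      rewrite eqxx => uf ur; rewrite /new uf ur -/(new r) newS //; split=> //.
      by apply: contraNneq (fr u uf ur) => ->.
    rewrite Ff // => ue ut; rewrite !newS; [exact: pof|exact: inS (tin _ eF)|exact: inS ue].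
  - rewrite 2!inE => /orP[/eqP->|eF]; last first.
      rewrite Ff // => th; have tS := inS _ _ eF (tin _ eF).
      have [pF tp tt] := tpar e eF th; rewrite newS // Ff // !inE pF orbT.
      by split.
    rewrite eqxx => rh; rewrite newS //.
    (* The new top [r] lies on an older edge, either as its top or not; both cases give [par r] in
       [F]. *)
    move: rS; rewrite !inE (negbTE rh) /= => /bigcupP[e' eF re].
    have [ret|ret] := eqVneq r (top e').
      have [pF tp tt] : [/\ par r \in F, r \in par r & r != top (par r)].
        by rewrite ret in rh *; exact: tpar.
      by rewrite Ff // pF orbT.
    have [pe _ _] := pof e' r eF re ret.
    by rewrite pe Ff // eF orbT.
move=> u; rewrite in_setU1 => /orP[/eqP->|]; first exact: connect0.
have sF : F \subset f |: F by exact: subsetUr.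
case/bigcupP=> e; rewrite in_setU1 => /orP[/eqP->|eF] ue; last first.
  by apply: connect_linkedS sF (cn u (inS _ _ eF ue)).
apply: connect_trans (connect_linkedS sF (cn r rS)) _.
apply: connect1; apply/exists_inP; exists f; first by rewrite !inE eqxx.
by rewrite rf.
Qed.

End Orientation.

(** * Paths in a rooted hypertree *)

Section Paths.
Variable T : hypergraph.

Definition is_path n (v : 'I_n.+1 -> T) (e : 'I_n -> {set T}) : Prop :=
  [/\ injective v, injective e &
      forall i : 'I_n, [/\ e i \in edges T,
        v (widen_ord (leqnSn n) i) \in e i & v (lift ord0 i) \in e i]].

Lemma is_path_rev n (v : 'I_n.+1 -> T) (e : 'I_n -> {set T}) :
  is_path v e -> is_path (v \o @rev_ord n.+1) (e \o @rev_ord n).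
Proof.
case=> vI eI ve; split.
- exact: inj_comp vI rev_ord_inj.
- exact: inj_comp eI rev_ord_inj.
- move=> i /=; have [eE a b] := ve (rev_ord i); split=> //.
    rewrite (_ : rev_ord _ = lift ord0 (rev_ord i)) //; apply: val_inj => /=.
    by rewrite /bump /=; have := ltn_ord i; lia.
  rewrite (_ : rev_ord _ = widen_ord (leqnSn n) (rev_ord i)) //.
  by apply: val_inj => /=; rewrite /bump /=; have := ltn_ord i; lia.
Qed.

End Paths.

Section Rooted.
Variables (T : hypergraph) (h : T).
Variables (top : {set T} -> T) (par : T -> {set T}) (dep : T -> nat).
Hypothesis ori : oriented h (edges T) top par dep.
Hypothesis conn : connected_hypergraph T.
Implicit Types (e : {set T}) (u : T).

Definition child_edges u : {set {set T}} := [set e in edges T | top e == u].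

Lemma par_eq e u : e \in edges T -> u \in e -> u != top e -> par u = e.
Proof. by move=> eE ue ut; have [] := par_of ori eE ue ut. Qed.

Lemma dep_nontop e u :
  e \in edges T -> u \in e -> u != top e -> dep u = (dep (top e)).+1.
Proof. by move=> eE ue ut; have [] := par_of ori eE ue ut. Qed.

Lemma top_at_root e : e \in edges T -> h \in e -> top e = h.
Proof.
move=> eE he; apply/eqP; apply: contraT; rewrite eq_sym => ht.
by have [_ _] := par_of ori eE he ht; rewrite eqxx.
Qed.

Lemma exists_edge u w : u != w -> exists2 e, e \in edges T & u \in e.
Proof.
move=> uw; have [n [v [e [_ _ v0 vn ve]]]] := conn u w.
case: n v e v0 vn ve => [|n] v e v0 vn ve.
  by case/eqP: uw; rewrite -v0 -vn; congr v; apply: val_inj.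
have [eE a _] := ve ord0; exists (e ord0) => //.
by rewrite -v0 (_ : ord0 = widen_ord (leqnSn n.+1) ord0) //; apply: val_inj.
Qed.

Lemma parP u : u != h ->
  [/\ par u \in edges T, u \in par u & u != top (par u)].
Proof.
move=> uh; have [e eE ue] := exists_edge uh.
have [ut|ut] := eqVneq u (top e); first by rewrite ut; apply: (top_par ori) => //; rewrite -ut.
by rewrite (par_eq eE ue ut).
Qed.

Lemma edges_at u e : u != h ->
  (e \in edges T) && (u \in e) = (e == par u) || (e \in child_edges u).
Proof.
move=> uh; have [pE up ut] := parP uh; apply/andP/orP => [[eE ue]|].
  have [->|ep] := eqVneq e (par u); [by left | right].
  rewrite inE eE eq_sym; apply: contraNT ep => ute.
  by rewrite (par_eq eE ue ute).
case=> [/eqP->//|]; rewrite inE => /andP[eE /eqP te]; split=> //.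
by rewrite -te (top_in ori).
Qed.

Lemma edges_at_root e : (e \in edges T) && (h \in e) = (e \in child_edges h).
Proof.
rewrite inE; case: (boolP (e \in edges T)) => //= eE.
apply/idP/eqP => [/(top_at_root eE)//|te].
by rewrite -te (top_in ori).
Qed.

Lemma par_notin_child_edges u : u != h -> par u \notin child_edges u.
Proof. by move=> uh; have [_ _] := parP uh; rewrite inE eq_sym => /negbTE->; rewrite andbF. Qed.

Lemma degree_child_edges u : u != h -> degree u = #|child_edges u|.+1.
Proof.
move=> uh; have -> : #|child_edges u|.+1 = #|par u |: child_edges u|.
  by rewrite cardsU1 par_notin_child_edges.
apply: eq_card => e.
by rewrite in_set edges_at // in_setU1.
Qed.

Lemma degree_root : degree h = #|child_edges h|.
Proof. by apply: eq_card => e; rewrite in_set edges_at_root. Qed.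

(** Sending each vertex other than [h] to its parent edge has fibres of size [m.-1], an edge without
    its top. *)
Lemma card_oriented m : uniform T m -> (#|T| = 1 + #|edges T| * m.-1)%N.
Proof.
move=> uni; have -> : #|T| = #|[set~ h]|.+1.
  by rewrite cardsC1 prednK //; apply/card_gt0P; exists h.
rewrite add1n; congr _.+1; rewrite -sum1_card.
rewrite (partition_big par (mem (edges T))) /=; last first.
  by move=> u; rewrite !inE => /parP[].
rewrite -sum_nat_const; apply: eq_bigr => e eE.
rewrite -(uni e eE) (cardsD1 (top e)) (top_in ori eE) add1n /= -sum1_card.
apply: eq_bigl => u; rewrite !inE; apply/andP/andP => [[uh /eqP pe]|[ut ue]].
  by have [_] := parP uh; rewrite pe.
by have [-> _ ->] := par_of ori eE ue ut; rewrite eqxx.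
Qed.

Section PathDepth.
Variables (n : nat) (v : 'I_n.+1 -> T) (e : 'I_n -> {set T}).
Hypothesis pth : is_path v e.

(** A step between two vertices other than the top counts as descending too. *)
Definition descending (i : 'I_n) : bool := v (lift ord0 i) != top (e i).

(** After a descending step the current vertex has the edge just used as its parent edge; the next
    edge is a different one, so this vertex is its top. *)
Lemma path_descend (i j : 'I_n) : i < j -> descending i ->
  descending j /\ dep (top (e i)) < dep (top (e j)).
Proof.
have [vI eI ve] := pth.
have step (a b : 'I_n) : b = a.+1 :> nat -> descending a ->
    descending b /\ dep (top (e a)) < dep (top (e b)).
  move=> ba da; have [aE _ va] := ve a; have [bE vb _] := ve b.
  have eq_v : lift ord0 a = widen_ord (leqnSn n) b by exact: val_inj.
  have tb : v (lift ord0 a) = top (e b).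
    apply/eqP; apply: contraT => nt; rewrite eq_v in nt.
    have := par_eq aE va da; rewrite eq_v (par_eq bE vb nt) => /eI ab.
    by move: ba; rewrite ab; lia.
  split; last by rewrite -tb (dep_nontop aE va da).
  rewrite /descending -tb; apply: contraTneq isT => /vI /(congr1 val) /=.
  by rewrite /bump /= ba; lia.
case: j => j jn /=; elim: j jn => [|j IHj] jn //.
rewrite ltnS leq_eqVlt => /orP[/eqP ij|ij] di.
  by apply: (step i (Ordinal jn)) => //=; rewrite ij.
have [dj lj] := IHj (ltnW jn) ij di.
have [dj' lj'] := step (Ordinal (ltnW jn)) (Ordinal jn) erefl dj.
by split=> //; apply: ltn_trans lj _.
Qed.

End PathDepth.

Lemma not_descending n (v : 'I_n.+1 -> T) (e : 'I_n -> {set T}) i :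
  is_path v e -> ~~ descending v e i ->
  descending (v \o @rev_ord n.+1) (e \o @rev_ord n) (rev_ord i).
Proof.
case=> vI eI ve; rewrite /descending negbK => /eqP vt /=.
rewrite rev_ordK -vt (inj_eq vI); apply/eqP => /(congr1 val) /=.
by rewrite /bump /=; have := ltn_ord i; lia.
Qed.

(** Depth strictly increases along descending steps and, by reversal, strictly decreases along the
    others. *)
Lemma path_depth_inj n (v : 'I_n.+1 -> T) (e : 'I_n -> {set T}) :
  is_path v e ->
  injective (fun i => (descending v e i, dep (top (e i)))).
Proof.
move=> pth i j [dij tij].
wlog ij : i j dij tij / i < j.
  move=> W; case: (ltngtP i j) => [ij|ij|/val_inj//]; first exact: W.
  by apply/esym/W.
have [di|/(not_descending pth) di] := boolP (descending v e i).
  by have [_] := path_descend pth ij di; rewrite tij ltnn.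
have [] := @path_descend _ _ _ (is_path_rev pth) (rev_ord j) (rev_ord i).
- by rewrite /= ; have := ltn_ord j; lia.
- by apply: not_descending => //; rewrite -dij; apply/negP => dj;
    have [_] := path_descend pth ij dj; rewrite tij ltnn.
by rewrite /= !rev_ordK tij ltnn.
Qed.

(** At a fixed depth the boolean [descending] alone separates the edges. *)
Lemma path_depth_card n (v : 'I_n.+1 -> T) (e : 'I_n -> {set T}) j :
  is_path v e ->
  #|[set f in [set e i | i : 'I_n] | dep (top f) == j]| <= 2.
Proof.
move=> pth; have [_ eI _] := pth.
have -> : [set f in [set e i | i : 'I_n] | dep (top f) == j] =
    e @: [set i | dep (top (e i)) == j].
  apply/setP => f; rewrite !inE; apply/andP/imsetP => [[/imsetP[i _ ->]]|[j']].
    by move=> ?; exists i; rewrite ?inE.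
  by rewrite inE => ? ->; rewrite imset_f.
rewrite card_imset // -card_bool.
rewrite -(@card_in_imset _ _ (descending v e)); first exact: max_card.
move=> i i'; rewrite !inE => /eqP ij /eqP ij' dd.
by apply: (path_depth_inj pth); rewrite dd ij ij'.
Qed.

End Rooted.

Local Open Scope ring_scope.

(** * Spectral radius *)

Section Spectral.
Variables (R : realType) (m : nat).
Implicit Type H : hypergraph.

Definition adjacent H (u w : H) : bool :=
  (u != w) && [exists e in edges H, (u \in e) && (w \in e)].

Lemma adjacent_sym H (u w : H) : adjacent u w = adjacent w u.
Proof.
rewrite /adjacent eq_sym; congr (_ && _).
by apply: eq_existsb => e; rewrite [(u \in e) && _]andbC.
Qed.

Definition is_eigenfunction H (z : R[i]) (x : H -> R[i]) : Prop :=
  (exists u, x u != 0) /\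
  (forall u, (m.-1%:R^-1)%:C%C * (\sum_(w | adjacent u w) x w) = z * x u).

(** [eigenvalue] refers to row vectors; the symmetry of [adjacent] turns them into functions
    satisfying the equation at each vertex. *)
Lemma eigenvalue_adjacency H (z : R[i]) :
  eigenvalue (map_mx (real_complex R) (adjacency_matrix R m H)) z <->
  exists x : H -> R[i], is_eigenfunction z x.
Proof.
have sumE (x : H -> R[i]) u :
    \sum_(i < #|H|) x (enum_val i) *
       map_mx (real_complex R) (adjacency_matrix R m H) i (enum_rank u)
    = (m.-1%:R^-1)%:C%C * \sum_(w | adjacent u w) x w.
  rewrite (reindex_onto enum_rank enum_val) /=; last by move=> i _; rewrite enum_valK.
  rewrite mulr_sumr [RHS]big_mkcond; apply: eq_big => [w|w _].
    by rewrite enum_rankK eqxx.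
  rewrite !mxE !enum_rankK (inj_eq enum_rank_inj) -/(adjacent w u) adjacent_sym.
  by case: ifP => _; rewrite ?mulr0 // mulrC.
split=> [/eigenvalueP[v vE v0] | [x [[u xu0] xE]]].
  exists (fun u => v 0 (enum_rank u)); split.
    case/rV0Pn: v0 => i vi; exists (enum_val i); by rewrite enum_valK.
  move=> u; rewrite -sumE.
  move/rowP/(_ (enum_rank u)): vE; rewrite mxE [in RHS]mxE => <-.
  by apply: eq_bigr => i _; rewrite enum_valK.
apply/eigenvalueP; exists (\row_i x (enum_val i)); last first.
  by apply/rV0Pn; exists (enum_rank u); rewrite mxE enum_rankK.
apply/rowP => i; rewrite -(enum_valK i) !mxE enum_rankK -xE -sumE.
by apply: eq_bigr => j _; rewrite mxE.
Qed.

Lemma isomorphic_adjacent (G H : hypergraph) (f : G -> H) :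
  bijective f -> (forall e : {set G}, (f @: e \in edges H) = (e \in edges G)) ->
  forall u w, adjacent (f u) (f w) = adjacent u w.
Proof.
move=> bf fE u w; have fI := bij_inj bf; case: (bf) => g gK fK.
rewrite /adjacent (inj_eq fI); congr (_ && _).
apply/exists_inP/exists_inP => -[e eE /andP[ue we]].
  exists (g @: e).
    rewrite -fE -imset_comp; suff -> : (f \o g) @: e = e by [].
    by rewrite -[RHS]imset_id; apply: eq_imset => x /=; rewrite fK.
  by rewrite -[u]gK -[w]gK !imset_f.
by exists (f @: e); rewrite ?fE // !imset_f.
Qed.

Lemma lambda1_isomorphic (G H : hypergraph) :
  isomorphic G H -> lambda1 R m G = lambda1 R m H.
Proof.
case=> f bf fE; rewrite /lambda1 /spectral_radius; congr (sup _).
have adjE := isomorphic_adjacent bf fE; case: (bf) => g gK fK.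
apply/seteqP; split=> r /= [z /eigenvalue_adjacency[x [[u xu] xE]] zr];
  exists z => //; apply/eigenvalue_adjacency.
  exists (x \o g); split=> [|v]; first by exists (f u); rewrite /= gK.
  rewrite /= -xE; congr (_ * _); rewrite (reindex f) /=; last first.
    by exists g => ? _.
  by apply: eq_big => [w|w _]; rewrite ?gK // -{1}[v]fK adjE.
exists (x \o f); split=> [|v]; first by exists (g u); rewrite /= fK.
rewrite /= -xE; congr (_ * _); rewrite [RHS](reindex f) /=; last first.
  by exists g => ? _.
by apply: eq_bigl => w; rewrite adjE.
Qed.

Section Bound.
Variable H : hypergraph.
Let M : R := m.-1%:R.

Lemma sum_adjacent_le (x : H -> R) (u : H) : (forall v, 0 <= x v) ->
  \sum_(w | adjacent u w) x w <=
  \sum_(e in edges H | u \in e) \sum_(w in e | w != u) x w.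
Proof.
move=> x0; under [leRHS]eq_bigr do rewrite big_mkcondl /=.
rewrite exchange_big /= [leLHS]big_mkcond [leRHS]big_mkcond /=.
apply: ler_sum => w _; rewrite /adjacent eq_sym.
case: eqVneq => //= wu; case: ifP => [/exists_inP[e eE /andP[ue we]]|_].
  rewrite (bigD1 e) ?eE ?ue //= we lerDl sumr_ge0 // => e' _.
  by case: ifP.
by apply: sumr_ge0 => e _; case: ifP.
Qed.

Lemma rayleigh_le (y : {set H} -> H -> R) (r : R) (x : H -> R) :
  (forall e u, e \in edges H -> u \in e -> 0 < y e u) ->
  (forall u, \sum_(e in edges H | u \in e)
               \sum_(w in e | w != u) y e w / y e u <= r) ->
  (forall u, 0 <= x u) ->
  \sum_u x u * (\sum_(w | adjacent u w) x w) <= r * \sum_u x u ^+ 2.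
Proof.
move=> y0 yr x0.
(* [S] sums over ordered pairs of distinct vertices of an edge; [SE] groups the pairs by first
   vertex and [SC] exchanges the two. *)
pose S (F : {set H} -> H -> H -> R) :=
  \sum_(e in edges H) \sum_(u in e) \sum_(w in e | w != u) F e u w.
have SE (F : {set H} -> H -> H -> R) :
    \sum_u \sum_(e in edges H | u \in e) \sum_(w in e | w != u) F e u w = S F.
  rewrite /S; under eq_bigr do rewrite big_mkcondr.
  by rewrite exchange_big; apply: eq_bigr => e _; rewrite -big_mkcond.
have SC (F : {set H} -> H -> H -> R) : S F = S (fun e u w => F e w u).
  apply: eq_bigr => e _; under eq_bigr do rewrite big_mkcondr.
  under [RHS]eq_bigr do rewrite big_mkcondr.
  rewrite exchange_big; apply: eq_bigr => w _; apply: eq_bigr => u _.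
  by rewrite eq_sym.
pose F1 (e : {set H}) u w := x u * x w.
pose F2 (e : {set H}) u w := x u ^+ 2 * (y e w / y e u).
have le1 : \sum_u x u * (\sum_(w | adjacent u w) x w) <= S F1.
  rewrite -SE; apply: ler_sum => u _.
  apply: le_trans (ler_wpM2l (x0 u) (sum_adjacent_le u x0)) _.
  by rewrite mulr_sumr; under eq_bigr do rewrite mulr_sumr.
have le2 : S F2 <= r * \sum_u x u ^+ 2.
  rewrite -SE mulr_sumr; apply: ler_sum => u _.
  rewrite /F2 [leRHS]mulrC.
  under eq_bigr do rewrite -mulr_sumr.
  by rewrite -mulr_sumr ler_wpM2l ?sqr_ge0.
apply: le_trans le1 (le_trans _ le2).
(* AM-GM: [2 x_u x_w <= x_u^2 y_w / y_u + x_w^2 y_u / y_w] *)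
suff : S F1 + S F1 <= S F2 + S F2 by lra.
rewrite [X in _ <= _ + X]SC -!big_split /=.
apply: ler_sum => e eE; rewrite -!big_split /=.
apply: ler_sum => u ue; rewrite -!big_split /=.
apply: ler_sum => w /andP[we _].
rewrite /F1 /F2; have yu := y0 e u eE ue; have yw := y0 e w eE we.
set a := x u; set b := x w; set s := y e u in yu *; set t := y e w in yw *.
have st0 : 0 < s * t by rewrite mulr_gt0.
rewrite -subr_ge0.
have -> : a ^+ 2 * (t / s) + b ^+ 2 * (s / t) - (a * b + a * b) =
   (a * t - b * s) ^+ 2 / (s * t).
  by field; rewrite (gt_eqF yu) (gt_eqF yw).
by rewrite divr_ge0 ?sqr_ge0 // ltW.
Qed.

(** By the triangle inequality the moduli [x] of an eigenvector satisfy
    [s * x u <= M^-1 * \sum_w x w]; pairing this with [x] brings in [rayleigh_le]. *)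
Lemma eigenvalue_le (y : {set H} -> H -> R) (r : R) :
  (1 < m)%N ->
  (forall e u, e \in edges H -> u \in e -> 0 < y e u) ->
  (forall u, \sum_(e in edges H | u \in e)
               \sum_(w in e | w != u) y e w / y e u <= M * r) ->
  forall z s,
  eigenvalue (map_mx (real_complex R) (adjacency_matrix R m H)) z ->
  `|z| = real_complex R s -> s <= r.
Proof.
move=> m1 y0 yr z s /eigenvalue_adjacency[v [[u0 vu0] vE]] zs.
have M0 : 0 < M by rewrite ltr0n; lia.
pose x u := complex.Re `|v u|.
have xE u : `|v u| = (x u)%:C%C by rewrite /x [in RHS]RRe_real // normr_real.
have x0 u : 0 <= x u by rewrite -lecR -xE normr_ge0.
have sx u : s * x u <= M^-1 * \sum_(w | adjacent u w) x w.
  rewrite -lecR !rmorphM /= -zs -xE -normrM -vE normrM rmorph_sum /=.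
  rewrite ger0_norm ?ler_wpM2l ?lecR ?invr_ge0 ?ler0n //; last first.
  apply: le_trans (ler_norm_sum _ _ _) _.
  by apply: ler_sum => w _; rewrite xE.
have sq0 : 0 < \sum_u x u ^+ 2.
  rewrite (bigD1 u0) //= ltr_pwDl ?sumr_ge0 // => [|u _]; last exact: sqr_ge0.
  rewrite exprn_gt0 // lt0r x0 andbT; apply: contraNneq vu0 => x00.
  by rewrite -normr_eq0 xE x00.
rewrite -(ler_pM2r sq0) -(ler_pM2l M0) mulrA.
rewrite [leRHS]mulrA; apply: le_trans (rayleigh_le y0 yr x0).
rewrite mulr_sumr; apply: ler_sum => u _.
have -> : M * s * x u ^+ 2 = x u * (M * (s * x u)) by ring.
apply: ler_wpM2l => //.
apply: le_trans (ler_wpM2l (ltW M0) (sx u)) _.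
by rewrite mulrA divff ?gt_eqF // mul1r.
Qed.

Lemma lambda1_le (y : {set H} -> H -> R) (r : R) :
  (1 < m)%N -> 0 <= r ->
  (forall e u, e \in edges H -> u \in e -> 0 < y e u) ->
  (forall u, \sum_(e in edges H | u \in e)
               \sum_(w in e | w != u) y e w / y e u <= M * r) ->
  lambda1 R m H <= r.
Proof.
move=> m1 r0 y0 yr; rewrite /lambda1 /spectral_radius.
set E := (X in sup X).
(* The supremum of the empty set is 0 by convention. *)
have [->|E0] := eqVneq E classical_sets.set0; first by rewrite sup0.
apply: ge_sup; first exact/set0P.
by move=> s [z ez zs]; exact: eigenvalue_le y0 yr _ _ ez zs.
Qed.

(** Using [x] as the weights on every edge gives the upper bound, and [r] is itself an eigenvalue:
    by linearity a neighbour shares exactly one edge with [u], so the sums over edges are sums over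
    neighbours. *)
Lemma lambda1_positive_eigenfunction (x : H -> R) (r : R) (u0 : H) :
  (1 < m)%N -> 0 <= r -> linear_hypergraph H ->
  (forall u, 0 < x u) ->
  (forall u, \sum_(e in edges H | u \in e) \sum_(w in e | w != u) x w
             = M * r * x u) ->
  lambda1 R m H = r.
Proof.
move=> m1 r0 lin x0 xE.
have M0 : 0 < M by rewrite ltr0n; lia.
have bound : forall z s,
    eigenvalue (map_mx (real_complex R) (adjacency_matrix R m H)) z ->
    `|z| = real_complex R s -> s <= r.
  apply: (@eigenvalue_le (fun _ => x)) => // u.
  under eq_bigr do rewrite -mulr_suml.
  by rewrite -mulr_suml xE -mulrA divff ?mulr1 // gt_eqF.
have inE : exists2 z : R[i],
    eigenvalue (map_mx (real_complex R) (adjacency_matrix R m H)) z &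
    `|z| = real_complex R r.
  exists r%:C%C; last by rewrite ger0_norm // lecR.
  apply/eigenvalue_adjacency; exists (fun u => (x u)%:C%C); split.
    by exists u0; rewrite (inj_eq (@complexI R)) gt_eqF.
  move=> u; rewrite -!rmorph_sum -!rmorphM /=; congr (_ %:C%C).
  suff -> : \sum_(w | adjacent u w) x w =
     \sum_(e in edges H | u \in e) \sum_(w in e | w != u) x w.
    by rewrite xE /M -mulrA mulKf // gt_eqF.
  under [RHS]eq_bigr do rewrite big_mkcondl /=.
  rewrite exchange_big /= [LHS]big_mkcond [RHS]big_mkcond /=.
  apply: eq_bigr => w _; rewrite /adjacent eq_sym.
  case: eqVneq => //= wu; case: ifP => [/exists_inP[e eE /andP[ue we]]|].
    rewrite (bigD1 e) ?eE ?ue //= we big1 ?addr0 // => e' /andP[/andP[e'E ue'] ee'].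
    case: ifP => // we'; have := lin e' e e'E eE ee'.
    rewrite leqNgt; move/negP; case; rewrite (cardsD1 u) (cardsD1 w) !inE.
    by rewrite wu ue ue' we we'.
  move=> /negbT/exists_inPn nadj; apply/esym/big1 => e /andP[eE ue].
  by case: ifP => // we; have := nadj e eE; rewrite ue we.
apply/eqP; rewrite eq_le; apply/andP; split.
  apply: ge_sup; first by exists r.
  by move=> s [z ez zs]; exact: bound ez zs.
apply: ub_le_sup; last exact: inE.
by exists r => s [z ez zs]; exact: bound ez zs.
Qed.

End Bound.
End Spectral.

(** * Hypertrees without a large hub *)

Section Excess.
Variables (R : realType) (T : hypergraph) (h : T).
Variables (top : {set T} -> T) (par : T -> {set T}) (dep : T -> nat).
Hypothesis ori : oriented h (edges T) top par dep.
Variable mu : R.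
Hypothesis mu0 : 0 <= mu.
Implicit Types (e : {set T}) (u : T).

(** The edges hanging below [e]. As [par h] is arbitrary, edges with top [h] are excluded
    explicitly. *)
Definition kids e : {set {set T}} :=
  [set f in edges T | (par (top f) == e) && (top f != h)].

(* Fuel-indexed, the fuel being the height still available below [e]. *)
Fixpoint excess_rec k e : R :=
  if k is k'.+1 then 10%:R^-1 * \sum_(f in kids e) (mu + excess_rec k' f) else 0.

Definition edge_depth e : nat := dep (top e).
Definition height : nat := (\max_(e in edges T) edge_depth e)%N.
Definition excess e : R := excess_rec (height - edge_depth e) e.

Lemma edge_depth_le e : e \in edges T -> (edge_depth e <= height)%N.
Proof. by move=> eE; apply: leq_bigmax_cond. Qed.

Lemma kids_depth e f : f \in kids e ->
  [/\ f \in edges T, e \in edges T & edge_depth f = (edge_depth e).+1].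
Proof.
rewrite inE => /and3P[fE /eqP pe th]; have [pE tp tt] := top_par ori fE th.
split=> //; first by rewrite -pe.
by rewrite /edge_depth -pe; have [] := par_of ori pE tp tt.
Qed.

Lemma excess_rec_ge0 k e : 0 <= excess_rec k e.
Proof.
elim: k e => //= k IHk e; rewrite mulr_ge0 ?invr_ge0 ?ler0n // sumr_ge0 // => f _.
by rewrite addr_ge0.
Qed.

Lemma excess_ge0 e : 0 <= excess e.
Proof. exact: excess_rec_ge0. Qed.

(** The fuel is zero only at maximal depth, where an edge has no kids. *)
Lemma excessE e : e \in edges T ->
  excess e = 10%:R^-1 * \sum_(f in kids e) (mu + excess f).
Proof.
move=> eE; rewrite /excess; case E: (height - edge_depth e)%N => [|k] /=.
  rewrite big_pred0 ?mulr0 // => f; apply/negbTE/negP => /kids_depth[fE _ df].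
  by have := edge_depth_le fE; lia.
congr (_ * _); apply: eq_bigr => f /kids_depth[fE _ df].
by rewrite (_ : height - edge_depth f = k)%N //; lia.
Qed.

Variable P : {set {set T}}.
Hypothesis PE : P \subset edges T.
Hypothesis P2 : forall j, (#|[set f in P | edge_depth f == j]| <= 2)%N.

(* [2 / 9] is [2 (1 / 10 + 1 / 100 + ...)]: each deeper level holds at most two
   edges of [P]. *)
Lemma excess_level_le j :
  \sum_(e in edges T | edge_depth e == j) excess e <=
  mu * (10%:R^-1 * #|[set e in edges T :\: P | (j < edge_depth e)%N]|%:R + 2 / 9).
Proof.
have [k kE] : exists k, k = (height - j)%N by exists (height - j)%N.
elim: k j kE => [|k IHk] j kE.
  rewrite big1 ?(mulr_ge0, addr_ge0, invr_ge0, ler0n) // => e /andP[eE /eqP de].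
  by rewrite /excess de -kE.
have := IHk j.+1; rewrite (_ : k = height - j.+1)%N; last lia.
move=> /(_ erefl); set Y' := \sum_(e in _ | _) _; set n' := #|_| => IH.
(* Each edge of level [j.+1] is a kid of exactly one edge of level [j]. *)
have -> : \sum_(e in edges T | edge_depth e == j) excess e =
    10%:R^-1 * \sum_(f in edges T | edge_depth f == j.+1) (mu + excess f).
  rewrite [in RHS](partition_big (fun f => par (top f))
     (fun e => (e \in edges T) && (edge_depth e == j))) /=; last first.
    move=> f /andP[fE /eqP df]; have th : top f != h.
      apply/eqP => th; move: df.
      by rewrite /edge_depth th (dep_root ori).
    have [pE tp tt] := top_par ori fE th; rewrite pE.
    by move: df; rewrite /edge_depth; have [_ -> _] := par_of ori pE tp tt; lia.
  rewrite mulr_sumr; apply: eq_bigr => e /andP[eE /eqP de].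
  rewrite excessE //; congr (_ * _); apply: eq_bigl => f.
  apply/idP/idP => [fe|/andP[/andP[fE /eqP df] pe]].
    by have [-> _ ->] := kids_depth fe; rewrite de eqxx; move: fe; rewrite inE => /and3P[_ ->].
  rewrite inE fE pe /=; apply/eqP => th.
  by move: df; rewrite /edge_depth th (dep_root ori).
rewrite big_split /= -/Y' sumr_const.
set c := #|_|; set N := #|_|.
(* Level [j.+1] consists of the edges counted in [N] but not in [n'], and of at most two edges of
   [P]. *)
have cN : (c + n' <= N + 2)%N.
  apply: (@leq_trans (#|[set e in edges T :\: P | edge_depth e == j.+1]| +
     #|[set f in P | edge_depth f == j.+1]| + n')%N).
    have -> : c = #|[set e in edges T | edge_depth e == j.+1]|.
      by apply: eq_card => f; rewrite inE.
    rewrite leq_add2r -(cardsID P) addnC leq_add //.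
      apply/subset_leq_card/subsetP => f.
      by rewrite !inE => /and3P[-> -> ->].
    by apply/subset_leq_card/subsetP => f; rewrite !inE => /andP[/andP[_ ->] ->].
  rewrite addnAC leq_add ?P2 // /N -cardsUI [X in (_ + X)%N]eq_card0 ?addn0.
    apply/subset_leq_card/subsetP => f; rewrite !inE.
    by case/orP=> /andP[-> df] /=; move: df; lia.
  by move=> f; rewrite !inE; apply/negbTE/negP => /andP[/andP[_ df] /andP[_]]; lia.
have cN' : c%:R + n'%:R <= N%:R + 2 :> R by rewrite -!natrD ler_nat.
(* The constants close up because [2 / 10 + 2 / 90 = 2 / 9]. *)
rewrite -[mu *+ c]mulr_natr.
have : mu * (c%:R + n'%:R) <= mu * (N%:R + 2) by apply: ler_wpM2l.
have : 0 <= mu * N%:R by rewrite mulr_ge0 ?ler0n.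
have : 0 <= mu * n'%:R by rewrite mulr_ge0 ?ler0n.
lra.
Qed.

End Excess.

Section EdgeConstants.
Variable R : realType.
Variables M q : R.

(* If [lambda * M = q + M - 1], a pendant edge at a vertex of value 1 contributes
   [M / q = edge_factor * edge_gain] to the eigenvalue equation there, and an edge
   whose other non-pendant vertex has value [1 / q + s] contributes
   [edge_factor * (edge_gain + s)]. *)
Definition edge_gain : R := M * (q + 1) / (q * (q + M)).
Definition edge_factor : R := (q + M) / (q + 1).

Local Notation mu := edge_gain.
Local Notation c := edge_factor.

Lemma edge_gain_gt0 : 1 <= M -> 7 <= q -> 0 < mu.
Proof. by move=> M1 q7; rewrite /edge_gain divr_gt0 ?mulr_gt0 ?addr_gt0 //; lra. Qed.

Lemma edge_factor_gt0 : 1 <= M -> 7 <= q -> 0 < c.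
Proof. by move=> M1 q7; rewrite /edge_factor divr_gt0 ?addr_gt0 //; lra. Qed.

Lemma edge_gain_mulq : 1 <= M -> 7 <= q -> mu * q <= q + 1.
Proof.
move=> M1 q7.
have -> : mu * q = M * (q + 1) / (q + M).
  by rewrite /edge_gain; field; rewrite !gt_eqF //; lra.
by rewrite ler_pdivrMr; [nra|lra].
Qed.

Lemma edge_factor_gain : 1 <= M -> 7 <= q -> c * mu = M / q.
Proof. by move=> M1 q7; rewrite /edge_factor /edge_gain; field; rewrite !gt_eqF //; lra. Qed.

Lemma edge_factor_pendant : 1 <= M -> 7 <= q -> c * (1 + q^-1) = 1 + M / q.
Proof. by move=> M1 q7; rewrite /edge_factor; field; rewrite !gt_eqF //; lra. Qed.

Lemma edge_factor_q : 1 <= M -> 7 <= q -> c * (q + 1) = q + M.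
Proof. by move=> M1 q7; rewrite /edge_factor; field; rewrite !gt_eqF //; lra. Qed.

(** The equation for [q] amounts to [M * (n + 1) = (q - 1) * (q + M)], which cancels the factor
    [q + M] of the gain. *)
Lemma edge_gain_hub n : 1 <= M -> 7 <= q ->
  q * (q + M - 1) = (n + 2) * M -> mu * (n + 1) = q - q^-1.
Proof.
move=> M1 q7 qE; have q0 : q != 0 by rewrite gt_eqF //; lra.
have qM : q + M != 0 by rewrite gt_eqF //; lra.
have nE : M * (n + 1) = (q - 1) * (q + M) by rewrite mulrDr [M * n]mulrC; lra.
have -> : mu * (n + 1) = (q + 1) * (M * (n + 1)) / (q * (q + M)).
  by rewrite /edge_gain; field; rewrite q0 qM.
by rewrite nE; field; rewrite q0 qM.
Qed.

(** Here [f] stands for the number of child edges at a vertex and [s] for their total excess. The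
    constant [101 / 90] comes from [3 / 2 + 2 / 9 = 3 / 5 + 101 / 90]. *)
Lemma load_bound n f s X : 1 <= M -> 7 <= q ->
  q * (q + M - 1) = (n + 2) * M ->
  2 * f <= n + 3 -> s <= mu * (10%:R^-1 * n + 2 / 9) -> X = mu * f + s ->
  X * q <= q ^+ 2 - 10.
Proof.
move=> M1 q7 qE fn sn XE.
have muq := edge_gain_mulq M1 q7; have mu0 := edge_gain_gt0 M1 q7.
have q0 : q != 0 by rewrite gt_eqF //; lra.
have nq : mu * (n + 1) * q = q ^+ 2 - 1.
  by rewrite (edge_gain_hub M1 q7 qE) mulrBl mulVf // expr2.
have X1 : X <= mu * (3 / 5 * (n + 1) + 101 / 90).
  rewrite XE; have : mu * f <= mu * ((n + 3) / 2).
    by apply: ler_wpM2l; [exact: ltW|lra].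
  by move: sn; lra.
have X2 : X * q <= mu * (3 / 5 * (n + 1) + 101 / 90) * q.
  by rewrite ler_wpM2r //; lra.
have X3 : mu * (3 / 5 * (n + 1) + 101 / 90) * q =
  3 / 5 * (q ^+ 2 - 1) + 101 / 90 * (mu * q) by rewrite -nq; ring.
(* What remains is [2 / 5 * q ^+ 2 - 101 / 90 * (q + 1) >= 10 - 3 / 5], true from [q = 7] on. *)
rewrite X3 in X2; nra.
Qed.

(** The claim is [(q - X) * t >= 1], and the left side is 1 plus [X / (10 * q)] times
    [q ^+ 2 - 10 - X * q]. So the factor [1 / 10] in the excess matches the 10 of [load_bound]. *)
Lemma load_step t X : 7 <= q -> 0 <= X -> X * q <= q ^+ 2 - 10 ->
  t = q^-1 + 10%:R^-1 * X -> t^-1 + X <= q.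
Proof.
move=> q7 X0 Xq tE; have q0 : q != 0 by rewrite gt_eqF //; lra.
have t0 : 0 < t by rewrite tE ltr_wpDr ?mulr_ge0 ?invr_gt0 //; lra.
rewrite -lerBrDr -[t^-1]mul1r ler_pdivrMr // tE.
have -> : (q - X) * (q^-1 + 10%:R^-1 * X) =
   1 + X / q / 10%:R * (q ^+ 2 - 10%:R - X * q) by field.
rewrite lerDl mulr_ge0 ?divr_ge0 ?subr_ge0 //; lra.
Qed.

End EdgeConstants.

(** * Weights on a hypertree whose degrees are at most [n.+1] *)

Section NoHub.
Variables (R : realType) (m n : nat) (T : hypergraph) (h : T).
Variables (top : {set T} -> T) (par : T -> {set T}) (dep : T -> nat).
Hypothesis ori : oriented h (edges T) top par dep.
Hypothesis conn : connected_hypergraph T.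
Hypothesis m1 : (1 < m)%N.
Hypothesis uni : uniform T m.
Hypothesis two_non_pendant : forall e : {set T}, e \in edges T ->
  (#|[set v in e | non_pendant v]| <= 2)%N.
Let M : R := m.-1%:R.
Variable q : R.
Hypothesis q7 : 7 <= q.
Hypothesis qE : q * (q + M - 1) = (n%:R + 2) * M.
Variable P : {set {set T}}.
Hypothesis PE : P \subset edges T.
Hypothesis P2 :
  forall j, (#|[set f in P | edge_depth top dep f == j]| <= 2)%N.
Hypothesis cardP : #|edges T :\: P| = n.
Hypothesis h2 : (1 < degree h)%N.
Hypothesis hn : (degree h <= n.+1)%N.
Hypothesis hmax : forall v : T, (degree v <= degree h)%N.

Local Notation mu := (edge_gain M q).
Local Notation c := (edge_factor M q).
Local Notation down := (child_edges top).
Local Notation kids := (kids h top par).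
Local Notation excess := (excess h top par dep mu).

Let M1 : 1 <= M.
Proof. by rewrite ler1n; lia. Qed.

Let q_gt0 : 0 < q. Proof. by move: q7; lra. Qed.
Let mu0 : 0 <= mu. Proof. exact/ltW/edge_gain_gt0. Qed.
Let exc0 e : 0 <= excess e. Proof. exact: excess_ge0. Qed.

(* On [e] the top has weight 1, the other non-pendant vertex, if any, has weight
   [tilt e], and the pendant ones the weight solving their eigenvalue equation;
   for an edge without a second non-pendant vertex [excess e = 0], and both
   formulas give [1 / q]. *)
Definition tilt (e : {set T}) : R := q^-1 + excess e.

Definition edge_weight (e : {set T}) (u : T) : R :=
  if u == top e then 1 else
  if non_pendant u then tilt e else (1 + tilt e) / (q + 1).

Lemma tilt_gt0 e : 0 < tilt e.
Proof. by rewrite ltr_wpDr ?invr_gt0. Qed.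

Lemma edge_weight_gt0 e u : 0 < edge_weight e u.
Proof.
rewrite /edge_weight; have := tilt_gt0 e; case: eqP => // _; case: ifP => // _.
by move=> t0; rewrite divr_gt0 //; (move: q7 M1 q_gt0; lra).
Qed.

Lemma top_non_pendant e : e \in edges T -> non_pendant (top e).
Proof.
move=> eE; have [->//|th] := eqVneq (top e) h.
rewrite /non_pendant (degree_child_edges ori conn th) ltnS card_gt0.
by apply/set0Pn; exists e; rewrite inE eE eqxx.
Qed.

(** The top is non-pendant already, which leaves room for one more such vertex. *)
Lemma non_pendant_unique e u w : e \in edges T -> u \in e -> w \in e ->
  u != top e -> w != top e -> non_pendant u -> non_pendant w -> u = w.
Proof.
move=> eE ue we ut wt un wn; apply/eqP; apply: contraT => uw.
have /subset_leq_card : [set top e; u; w] \subset [set v in e | non_pendant v].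
  apply/subsetP => x xs; rewrite inE.
  move: xs; rewrite !inE => /orP[/orP[]|] /eqP->; rewrite ?ue ?we //.
  by rewrite (top_in ori eE) top_non_pendant.
move/leq_trans/(_ (two_non_pendant eE)).
by rewrite setUC cardsU1 cards2 !inE negb_or wt (eq_sym w u) uw (eq_sym (top e)) ut.
Qed.

(** The top of a kid of [e] is a non-pendant vertex of [e] other than [top e], and [u] is the only
    one. *)
Lemma kids_non_pendant e u : e \in edges T -> u \in e -> u != top e ->
  non_pendant u -> kids e = down u.
Proof.
move=> eE ue ut un; have [pu _ uh] := par_of ori eE ue ut.
apply/setP => f; rewrite !inE; case fE: (f \in edges T) => //=.
apply/andP/eqP => [[/eqP pf fh]|tf]; last by rewrite tf pu eqxx.
have [pE tp tt] := top_par ori fE fh; rewrite pf in pE tp tt.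
by apply: (non_pendant_unique eE) => //; exact: top_non_pendant.
Qed.

Lemma excess_pendant e : e \in edges T ->
  (forall u, u \in e -> u != top e -> ~~ non_pendant u) -> excess e = 0.
Proof.
move=> eE pend; rewrite (excessE ori) // big_pred0 ?mulr0 // => f.
apply/negbTE/negP; rewrite inE => /and3P[fE /eqP pf fh].
have [pE tp tt] := top_par ori fE fh; rewrite pf in tp tt.
by have := pend _ tp tt; rewrite top_non_pendant.
Qed.

Lemma sum_edge_weight e : e \in edges T ->
  \sum_(w in e) edge_weight e w = (1 + tilt e) * c.
Proof.
move=> eE; rewrite (bigD1 (top e)) ?(top_in ori) //=.
rewrite {1}/edge_weight eqxx.
have qq : q + 1 != 0 by rewrite gt_eqF //; (move: q7 M1 q_gt0; lra).
(* With a second non-pendant vertex there are [M - 1] pendant ones. Without it there are [M], and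
   [tilt e = q^-1] brings the total to the same form. *)
have [w /and3P[we wt wn]|none] := pickP [pred w | [&& w \in e, w != top e & non_pendant w]].
  rewrite (bigD1 w) ?we //= {1}/edge_weight (negbTE wt) wn.
  rewrite (eq_bigr (fun=> (1 + tilt e) / (q + 1))); last first.
    move=> v /andP[/andP[ve vt] vw]; rewrite /edge_weight (negbTE vt) ifN //.
    by apply: contra vw => vn; apply/eqP; apply: (non_pendant_unique eE).
  rewrite sumr_const (_ : #|_| = m.-2); last first.
    rewrite -(uni eE) (cardsD1 (top e)) (top_in ori eE) add1n /=.
    rewrite (cardsD1 w) !inE wt we add1n /=; apply: eq_card => v.
    by rewrite !inE unfold_in /= [v != w]/(~~ _) andbC [(v \in e) && _]andbC.
  rewrite -[_ *+ m.-2]mulr_natr (_ : m.-2%:R = M - 1); last first.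
    by rewrite /M -(natrB _ (n := 1)) ?subn1 //; lia.
  by rewrite /edge_factor; field.
rewrite (eq_bigr (fun=> (1 + tilt e) / (q + 1))); last first.
  move=> v /andP[ve vt]; rewrite /edge_weight (negbTE vt) ifN //.
  by have := none v; rewrite /= ve vt /= => ->.
rewrite sumr_const (_ : #|_| = m.-1); last first.
  rewrite -(uni eE) (cardsD1 (top e)) (top_in ori eE) add1n /=.
  by apply: eq_card => v; rewrite !inE unfold_in /= andbC.
rewrite -[_ *+ _]mulr_natr -/M /tilt excess_pendant ?addr0; last first.
- by move=> u ue ut; have := none u; rewrite /= ue ut /= => ->.
- by [].
by rewrite /edge_factor; field; rewrite qq gt_eqF.
Qed.

Lemma sum_edge_ratio e u : e \in edges T -> u \in e ->
  \sum_(w in e | w != u) edge_weight e w / edge_weight e u =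
  (1 + tilt e) * c / edge_weight e u - 1.
Proof.
move=> eE ue; rewrite -mulr_suml -(sum_edge_weight eE) [in RHS](bigD1 u) //=.
by field; rewrite gt_eqF ?edge_weight_gt0.
Qed.

Lemma sum_down_ratio u :
  \sum_(e in down u) \sum_(w in e | w != u) edge_weight e w / edge_weight e u
  = c * (mu * #|down u|%:R + \sum_(e in down u) excess e).
Proof.
rewrite (eq_bigr (fun e => c * (mu + excess e))); last first.
  move=> e; rewrite inE => /andP[eE /eqP te].
  rewrite sum_edge_ratio // -?te ?(top_in ori) // /edge_weight eqxx divr1 /tilt.
  rewrite addrA mulrDl [_ * c]mulrC edge_factor_pendant // mulrDr edge_factor_gain //.
  by rewrite mulrC; ring.
by rewrite -mulr_sumr big_split sumr_const mulr_natr.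
Qed.

Lemma card_down_P u : (#|P :&: down u| <= 2)%N.
Proof.
apply: leq_trans (P2 (dep u)); apply/subset_leq_card/subsetP => f.
by rewrite !inE => /and3P[-> _ /eqP tf]; rewrite /edge_depth tf eqxx.
Qed.

Lemma sum_excess_root :
  \sum_(e in down h) excess e <= mu * (n.+2%:R - #|down h|%:R).
Proof.
rewrite (eq_bigl (fun e => (e \in edges T) && (edge_depth top dep e == 0%N))); last first.
  move=> e; rewrite inE; case eE: (e \in edges T) => //=.
  rewrite /edge_depth; apply/eqP/eqP => [->|]; first exact: dep_root ori.
  move=> d0; apply/eqP; apply: contraT => th.
  have [pE tp tt] := top_par ori eE th.
  by move: d0; have [_ -> _] := par_of ori pE tp tt.
apply: le_trans (excess_level_le ori mu0 PE P2 0) _; apply: ler_wpM2l => //.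
(* Put [D = n + 2 - #|down h|]. Counting edges gives [k <= D], and the degree bound at the root
   gives [D >= 1]; hence [k / 10 + 2 / 9 <= D]. *)
set k := #|[set e in _ | _]|.
have kn : (k + #|down h| <= n + 2)%N.
  rewrite -cardP -(cardsID P (down h)) setIC addnA [(_ + 2)%N]addnC [(k + _)%N]addnC -addnA.
  rewrite leq_add ?card_down_P // -cardsUI [X in (_ + X)%N]eq_card0 ?addn0.
    apply/subset_leq_card/subsetP => f; rewrite !inE.
    by case/orP=> /andP[-> // /andP[-> _]].
  move=> f; rewrite !inE; apply/negbTE/negP => /andP[/andP[_ df] /and3P[_ _ /eqP tf]].
  by move: df; rewrite /edge_depth tf (dep_root ori).
have dn : (#|down h| <= n.+1)%N by rewrite -(degree_root ori).
have : k%:R + #|down h|%:R <= n.+2%:R :> R by rewrite -natrD ler_nat; lia.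
have : #|down h|%:R <= n.+1%:R :> R by rewrite ler_nat.
have : 0 <= k%:R :> R by exact: ler0n.
by rewrite -[n.+2%:R]natr1; (move: q7 M1 q_gt0; lra).
Qed.

(** The child edges of [u] and of [h] are disjoint sets sharing at most [n] edges off [P], with at
    most two more each on [P]: at most [n + 4] in all. Maximality of the degree of [h] gives
    [#|down u| + 1 <= #|down h|]. *)
Lemma degree_child u : u != h -> (2 * #|down u| <= n + 3)%N.
Proof.
move=> uh; have := hmax u; rewrite (degree_child_edges ori conn uh) (degree_root ori) => du.
suff : (#|down u| + #|down h| <= n + 4)%N by lia.
rewrite -(cardsID P (down u)) -(cardsID P (down h)) setIC.
have := card_down_P u; have := card_down_P h; rewrite [down h :&: P]setIC.
suff : (#|down u :\: P| + #|down h :\: P| <= n)%N by lia.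
rewrite -cardP -cardsUI [X in (_ + X)%N]eq_card0 ?addn0.
  apply/subset_leq_card/subsetP => f; rewrite !inE.
  by case/orP=> /and3P[-> ->].
move=> f; rewrite !inE; apply/negbTE/negP => /andP[/and3P[_ _ /eqP tu] /and3P[_ _ /eqP th]].
by rewrite -tu th eqxx in uh.
Qed.

Lemma sum_excess_le u :
  \sum_(e in down u) excess e <= mu * (10%:R^-1 * n%:R + 2 / 9).
Proof.
apply: (@le_trans _ _ (\sum_(e in edges T | edge_depth top dep e == dep u) excess e)).
  rewrite [leLHS]big_mkcond [leRHS]big_mkcond; apply: ler_sum => e _.
  rewrite inE /edge_depth; case: (e \in edges T) => //=.
  by case: eqP => [->|_]; rewrite ?eqxx //; case: ifP.
apply: le_trans (excess_level_le ori mu0 PE P2 (dep u)) _; apply: ler_wpM2l => //.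
have : #|[set e in edges T :\: P | (dep u < edge_depth top dep e)%N]|%:R <= n%:R :> R.
  rewrite ler_nat -cardP; apply/subset_leq_card/subsetP => e.
  by rewrite !inE => /andP[].
by move: q7 M1 q_gt0; lra.
Qed.

(** The root is compared with a star of [n + 2] edges, a pendant vertex attains equality, and
    elsewhere [load_step] balances the parent edge against the child edges. *)
Lemma vertex_weight_le u :
  \sum_(e in edges T | u \in e)
    \sum_(w in e | w != u) edge_weight e w / edge_weight e u <= q + M - 1.
Proof.
have [->|uh] := eqVneq u h.
  rewrite (eq_bigl (fun e => e \in down h)); last first.
    by move=> e; rewrite -(edges_at_root ori).
  rewrite sum_down_ratio.
  have -> : q + M - 1 = c * (mu * n.+2%:R).
    rewrite mulrA edge_factor_gain // -[n.+2]addn2 natrD.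
    by rewrite -[LHS](mulKf (lt0r_neq0 q_gt0)) qE; field; rewrite gt_eqF.
  rewrite ler_pM2l ?edge_factor_gt0 //; have := sum_excess_root.
  by rewrite mulrBr; (move: q7 M1 q_gt0; lra).
have [pE pu ut] := parP ori conn uh.
rewrite (eq_bigl (fun e => e \in par u |: down u)); last first.
  by move=> e; rewrite (edges_at ori conn) // in_setU1.
rewrite big_setU1 ?(par_notin_child_edges ori conn) //= sum_down_ratio sum_edge_ratio //.
set e := par u in pE pu ut *; set X := mu * _ + _.
rewrite /edge_weight (negbTE ut).
have t0 := tilt_gt0 e; have c0 := edge_factor_gt0 M1 q7.
have [un|up] := boolP (non_pendant u); last first.
  have d0 : #|down u| = 0%N.
    by move: up; rewrite /non_pendant (degree_child_edges ori conn uh) ltnS -leqNgt leqn0 => /eqP.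
  have -> : X = 0.
    by rewrite /X d0 mulr0 add0r; move/cards0_eq: d0 => ->; rewrite big_set0.
  rewrite mulr0 addr0.
  have -> : (1 + tilt e) * c / ((1 + tilt e) / (q + 1)) = q + M.
    rewrite -(edge_factor_q M1 q7); field.
    by rewrite !gt_eqF //; (move: q7 M1 q_gt0; lra).
  exact: lexx.
have X0 : 0 <= X.
  by apply: addr_ge0; [rewrite mulr_ge0|rewrite sumr_ge0].
have Xq : X * q <= q ^+ 2 - 10.
  apply: (load_bound M1 q7 qE _ (sum_excess_le u) erefl).
  by rewrite -!natrM -!natrD ler_nat degree_child.
have tE : tilt e = q^-1 + 10%:R^-1 * X.
  rewrite /tilt (excessE ori) // (kids_non_pendant pE pu ut un).
  by rewrite big_split /= sumr_const /X mulr_natr.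
have := load_step q7 X0 Xq tE.
(* The total [c * (t^-1 + X) + c - 1], for [t = tilt e], is at most [c * (q + 1) - 1]. *)
rewrite -(ler_pM2l c0) -[q + M](edge_factor_q M1 q7).
have -> : (1 + tilt e) * c / tilt e - 1 + c * X = c + c * ((tilt e)^-1 + X) - 1.
  by field; rewrite gt_eqF.
by move: q7 M1 q_gt0; lra.
Qed.

Lemma lambda1_no_hub : lambda1 R m T <= (q + M - 1) / M.
Proof.
apply: (@lambda1_le R m T edge_weight) => //.
- by rewrite divr_ge0 ?ler0n //; (move: q7 M1 q_gt0; lra).
- by move=> e u _ _; exact: edge_weight_gt0.
- move=> u; rewrite -/M mulrCA divff ?mulr1; last by rewrite gt_eqF //; (move: q7 M1 q_gt0; lra).
  exact: vertex_weight_le.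
Qed.

End NoHub.

(** * The hypertrees T_d *)

Lemma sum_setU_disjoint (V : nmodType) (I : finType) (A B : {set I}) (F : I -> V) :
  [disjoint A & B] ->
  \sum_(i in A :|: B) F i = \sum_(i in A) F i + \sum_(i in B) F i.
Proof. by move=> dAB; rewrite -bigU //; apply: eq_bigl => i; rewrite inE. Qed.

Lemma linear_hypergraph_pair (H : hypergraph) :
  (forall (e f : {set H}) x y, e \in edges H -> f \in edges H -> x != y ->
     x \in e -> x \in f -> y \in e -> y \in f -> e = f) -> linear_hypergraph H.
Proof.
move=> H1 e f eE fE; apply: contraR; rewrite -ltnNge => /card_gt1P[x [y [xi yi xy]]].
case/setIP: xi => xe xf; case/setIP: yi => ye yf.
by apply/eqP; apply: (H1 e f x y).
Qed.

Section AttachedEdges.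
Variables (m d : nat) (cf : loose_path m d -> nat).
Hypothesis m1 : (1 < m)%N.
Local Notation G := (loose_path m d).
Local Notation H := (@attach_pendant_edges m G cf).

Definition path_edge (j : 'I_d) : {set H} := inl @: (loose_path_edge m j).
Definition hub_edge (s : attach_index cf) : {set H} := attached_edge m s.

Lemma edges_attach : edges H = (path_edge @: 'I_d) :|: (hub_edge @: attach_index cf).
Proof.
rewrite /= /attach_edges; congr (_ :|: _).
apply/setP => e; apply/imsetP/imsetP => -[x xE ->].
  by case/imsetP: xE => j _ ->; exists j.
by exists (loose_path_edge m x) => //; apply/imsetP; exists x.
Qed.

Lemma inl_path_edge (x : G) j : (inl x \in path_edge j) = (x \in loose_path_edge m j).
Proof. by rewrite mem_imset //; exact: inl_inj. Qed.

Lemma mem_path_edge_l (i : 'I_d.+1) j :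
  (inl (inl i) \in path_edge j) = (j == i :> nat) || (j.+1 == i).
Proof.
rewrite inl_path_edge !inE /= [X in _ || X](_ : _ = false) ?orbF; last first.
  by apply/negbTE/negP => /imsetP[].
rewrite !(inj_eq inl_inj) -!val_eqE /= /bump /= add1n.
by rewrite eq_sym [j.+1 == _]eq_sym.
Qed.

Lemma mem_path_edge_r i (a : 'I_(m - 2)) j :
  (inl (inr (i, a)) \in path_edge j) = (i == j).
Proof.
rewrite inl_path_edge !inE /=; apply/imsetP/eqP => [[a' _ [-> _]]//|->].
by exists a.
Qed.

Lemma mem_path_edge_attached x j : (inr x \in path_edge j) = false.
Proof. by apply/negbTE/negP => /imsetP[]. Qed.

Lemma mem_hub_edge_l (x : G) s : (inl x \in hub_edge s) = (x == tag s).
Proof.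
rewrite in_setU1 [X in _ || X](_ : _ = false) ?orbF; first by [].
by apply/negbTE/negP => /imsetP[].
Qed.

Lemma mem_hub_edge_r s a t : (inr (s, a) \in hub_edge t) = (s == t).
Proof.
rewrite in_setU1 /=; apply/imsetP/eqP => [[a' _ [-> _]]//|->].
by exists a.
Qed.

(** The vertex [inr (s, a0)] lies in the pendant edge of [s] only, which tells that edge from all
    others. *)
Let a0 : 'I_(m - 1) := Ordinal (ltac:(lia) : (0 < m - 1)%N).

Lemma path_edge_inj : injective path_edge.
Proof.
move=> i j /setP E; apply: val_inj; apply/eqP.
have := E (inl (inl (widen_ord (leqnSn d) i))).
have := E (inl (inl (widen_ord (leqnSn d) j))).
by rewrite !mem_path_edge_l /= !eqxx /=; lia.
Qed.

Lemma hub_edge_inj : injective hub_edge.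
Proof.
move=> s t /setP/(_ (inr (s, a0))); rewrite !mem_hub_edge_r eqxx.
by move/esym/eqP.
Qed.

Lemma sum_edges_attach (V : nmodType) (P : pred {set H}) (F : {set H} -> V) :
  \sum_(e in edges H | P e) F e =
  \sum_(j | P (path_edge j)) F (path_edge j) +
  \sum_(s | P (hub_edge s)) F (hub_edge s).
Proof.
rewrite big_mkcondr edges_attach sum_setU_disjoint /=; last first.
  rewrite disjoint_subset; apply/subsetP => e /imsetP[j _ ->].
  rewrite inE; apply/negP => /imsetP[s _ /setP/(_ (inr (s, a0)))].
  by rewrite mem_hub_edge_r mem_path_edge_attached eqxx.
rewrite big_imset /=; last by move=> ? ? _ _; exact: path_edge_inj.
rewrite [X in _ + X]big_imset /=; last by move=> ? ? _ _; exact: hub_edge_inj.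
by rewrite -!big_mkcond.
Qed.

(** Two path edges sharing two vertices agree by their indices; a pendant edge has a single old
    vertex, and its new vertices lie in no other edge. *)
Lemma linear_attach : linear_hypergraph H.
Proof.
apply: linear_hypergraph_pair => e f x y; rewrite edges_attach.
move=> /setUP[] /imsetP[i _ ->] /setUP[] /imsetP[j _ ->] xy.
- case: x xy => [[k|[k a]]|x]; rewrite ?mem_path_edge_attached ?mem_path_edge_r //;
    last by move=> _ /eqP -> /eqP->.
  case: y => [[l|[l b]]|y]; rewrite ?mem_path_edge_attached ?mem_path_edge_r //;
    last by move=> _ _ _ /eqP -> /eqP->.
  rewrite !mem_path_edge_l => kl ki kj li lj; congr path_edge; apply: val_inj => /=.
  have {kl}kl : nat_of_ord k != l by apply: contra kl => /eqP/val_inj->.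
  by move: kl ki kj li lj; lia.
- case: x xy => [x|x]; rewrite ?mem_path_edge_attached // mem_hub_edge_l.
  case: y => [y|y]; rewrite ?mem_path_edge_attached // mem_hub_edge_l.
  by move=> xy _ /eqP xs _ /eqP ys; rewrite xs ys eqxx in xy.
- case: x xy => [x|x]; rewrite ?mem_path_edge_attached // mem_hub_edge_l.
  case: y => [y|y]; rewrite ?mem_path_edge_attached // mem_hub_edge_l.
  by move=> xy /eqP xs _ /eqP ys; rewrite xs ys eqxx in xy.
- case: x xy => [x|[s a]]; rewrite ?mem_hub_edge_l ?mem_hub_edge_r; last by move=> _ /eqP-> /eqP->.
  case: y => [y|[s a]]; rewrite ?mem_hub_edge_l ?mem_hub_edge_r; last by move=> _ _ _ /eqP-> /eqP->.
  by move=> xy /eqP xs _ /eqP ys; rewrite xs ys eqxx in xy.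
Qed.

Section Eigenfunction.
Variables (R : realType) (q : R) (X : nat -> R) (r : nat -> nat).
Let M : R := m.-1%:R.
Local Notation mu := (edge_gain M q).
Local Notation c := (edge_factor M q).
Hypothesis q7 : 7 <= q.
Hypothesis X0 : forall j, (j <= d)%N -> 0 < X j.
Hypothesis d1 : (0 < d)%N.
Hypothesis cfl : forall i : 'I_d.+1, cf (inl i) = r i.
Hypothesis cfr : forall x, cf (inr x) = 0%N.
Hypothesis r0 : r 0 = 0%N.
Hypothesis rd : r d = 0%N.
Hypothesis Xstart : X 1 = q * X 0.
Hypothesis Xend : X d.-1 = q * X d.
Hypothesis Xmid : forall j, (0 < j < d)%N ->
  X j.-1 + X j.+1 = (q + q^-1 - mu * (r j).+1%:R) * X j.

(** The values [X j] are prescribed at v_(j+1); here and in [attach_value] the other vertices take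
    the value that solves their own equation. *)
Definition path_value (x : G) : R :=
  match x with
  | inl j => X j
  | inr (j, _) => (X j + X j.+1) / (q + 1)
  end.

Definition attach_value (x : H) : R :=
  match x with
  | inl y => path_value y
  | inr (s, _) => path_value (tag s) / q
  end.

Let M1 : 1 <= M.
Proof. by rewrite ler1n; lia. Qed.

Lemma path_value_gt0 x : 0 < path_value x.
Proof.
case: x => [j|[j a]] /=; first by rewrite X0 // -ltnS.
have j1 := X0 (ltn_ord j); have j0 := X0 (ltnW (ltn_ord j)).
by rewrite divr_gt0 ?addr_gt0 //; move: q7; lra.
Qed.

Lemma attach_value_gt0 x : 0 < attach_value x.
Proof.
case: x => [x|[s a]] /=; rewrite ?divr_gt0 ?path_value_gt0 //.
by move: q7; lra.
Qed.

Lemma sum_path_edge j :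
  \sum_(w in path_edge j) attach_value w = c * (X j + X j.+1).
Proof.
rewrite big_imset /=; last by move=> ? ? _ _; exact: inl_inj.
rewrite /loose_path_edge sum_setU_disjoint /=; last first.
  rewrite disjoint_subset; apply/subsetP => x; rewrite !inE => /orP[]/eqP->;
  by apply/negP => /imsetP[].
rewrite big_imset /=; last by move=> ? ? _ _ [].
rewrite big_setU1 ?inE /=; last first.
  by rewrite (inj_eq inl_inj) -val_eqE /= /bump /=; lia.
rewrite big_set1 /= /bump /= add1n sumr_const card_ord.
rewrite -[_ *+ _]mulr_natr (_ : (m - 2)%:R = M - 1); last first.
  by rewrite /M -(natrB _ (n := 1)) //; [congr _%:R; lia|lia].
rewrite /edge_factor; field; rewrite gt_eqF //; move: q7; lra.
Qed.

Lemma sum_hub_edge s :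
  \sum_(w in hub_edge s) attach_value w = (1 + M / q) * path_value (tag s).
Proof.
rewrite /hub_edge /attached_edge big_setU1 /=; last by apply/negP => /imsetP[].
rewrite big_imset /=; last by move=> ? ? _ _ [].
rewrite sumr_const card_ord -[_ *+ _]mulr_natr subn1 -/M.
by field; rewrite gt_eqF //; move: q7; lra.
Qed.

Lemma sum_others (e : {set H}) u : u \in e ->
  \sum_(w in e | w != u) attach_value w = \sum_(w in e) attach_value w - attach_value u.
Proof. by move=> ue; rewrite [in RHS](bigD1 u) //= addrAC subrr add0r. Qed.

Lemma card_hub_edges x : #|[set s : attach_index cf | x == tag s]| = cf x.
Proof.
rewrite -sum1_card (eq_bigl (fun s : attach_index cf => (tag s == x) && true)); last first.
  by move=> s; rewrite !inE andbT eq_sym.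
rewrite -(@sig_big_dep _ _ _ _ _ (fun y => y == x) (fun=> xpredT) (fun _ _ => 1%N)) /=.
by rewrite big_pred1_eq sum1_card card_ord.
Qed.

Lemma sum_adjacent_ord j (F : nat -> R) :
  \sum_(i < d | (i == j :> nat) || (i.+1 == j)) F i =
  (if (j < d)%N then F j else 0) + (if (0 < j <= d)%N then F j.-1 else 0).
Proof.
have -> : \sum_(i < d | (i == j :> nat) || (i.+1 == j)) F i =
   \sum_(i < d | i == j :> nat) F i + \sum_(i < d | (i.+1 == j)) F i.
  rewrite big_mkcond [in RHS]big_mkcond [X in _ + X]big_mkcond -big_split /=.
  apply: eq_bigr => i _; case: (eqVneq (i : nat) j) => [->|ij] /=.
    by rewrite (_ : (j.+1 == j) = false) ?addr0 //; lia.
  by rewrite add0r.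
rewrite big_ord1_eq; congr (_ + _).
case: j => [|j] /=; first by rewrite big_pred0.
by rewrite (eq_bigl (fun i : 'I_d => i == j :> nat)) ?big_ord1_eq.
Qed.

(** A path edge sums to [c] times its two end values, and a pendant edge at v_(j+1) contributes
    [c * mu * X j]; so the equation there reduces to [Xstart], [Xmid] or [Xend]. *)
Lemma attach_eigen u :
  \sum_(e in edges H | u \in e) \sum_(w in e | w != u) attach_value w =
  (q + M - 1) * attach_value u.
Proof.
under eq_bigr => e /andP[_ ue] do rewrite sum_others //.
have q0 : q != 0 by rewrite gt_eqF //; move: q7; lra.
have q10 : q + 1 != 0 by rewrite gt_eqF //; move: q7; lra.
have cq := edge_factor_q M1 q7; have cp := edge_factor_pendant M1 q7.
have cg := edge_factor_gain M1 q7.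
rewrite sum_edges_attach; case: u => [[j|[j a]]|[s a]].
- under eq_bigl do rewrite mem_path_edge_l.
  under [X in _ + X]eq_bigl do rewrite mem_hub_edge_l.
  under eq_bigr do rewrite sum_path_edge.
  under [X in _ + X]eq_bigr do rewrite sum_hub_edge.
  rewrite (sum_adjacent_ord j (fun i => c * (X i + X i.+1) - X j)) /=.
  have -> : \sum_(s : attach_index cf | inl j == tag s)
      ((1 + M / q) * path_value (tag s) - X j) = (r j)%:R * (c * mu * X j).
    rewrite (eq_bigr (fun=> c * mu * X j)); last first.
      by move=> s /eqP <- /=; rewrite cg; ring.
    by rewrite sumr_const mulr_natl -cfl -card_hub_edges; congr (_ *+ _); apply: eq_card => s; rewrite inE.
  have jd : (j <= d)%N by rewrite -ltnS.
  move: (nat_of_ord j) jd => {}j jd.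
  have ccp : c * q^-1 = 1 + M / q - c by rewrite -cp; ring.
  have [j0|j0] := posnP j.
    rewrite j0 d1 /= r0 mul0r Xstart !addr0.
    by transitivity ((c * (q + 1) - 1) * X 0); [ring|rewrite cq].
  rewrite jd /=; have [jlt|jge] := ltnP j d.
    have /Xmid mid : (0 < j < d)%N by rewrite j0.
    rewrite prednK //.
    have -> : X j.+1 = (q + q^-1 - mu * (r j).+1%:R) * X j - X j.-1 by rewrite -mid; ring.
    rewrite -natr1.
    transitivity ((c * (q + 1) + c * (1 + q^-1) - c * mu - 2) * X j); first by ring.
    by rewrite cq cp cg; ring.
  have -> : j = d by lia.
  rewrite rd prednK // Xend mul0r addr0 add0r.
  by transitivity ((c * (q + 1) - 1) * X d); [ring|rewrite cq].
- under eq_bigl do rewrite mem_path_edge_r eq_sym.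
  rewrite big_pred1_eq [X in _ + X]big_pred0 ?addr0; last first.
    move=> [x k]; rewrite mem_hub_edge_l /=.
    by apply/negbTE/eqP => xE; case: k; rewrite -xE cfr.
  rewrite sum_path_edge /=.
  transitivity ((c * (q + 1) - 1) * ((X j + X j.+1) / (q + 1))); last by rewrite cq.
  by field.
- under eq_bigl do rewrite mem_path_edge_attached.
  rewrite big_pred0_eq add0r.
  under eq_bigl do rewrite mem_hub_edge_r eq_sym.
  rewrite big_pred1_eq sum_hub_edge /=; field; exact: q0.
Qed.

End Eigenfunction.
End AttachedEdges.

(** * The recurrence along an arm and the equation at the hub *)

Section Arms.
Variables (R : realType) (M : R).
Hypothesis M1 : 1 <= M.
Local Notation mu := (edge_gain M).

(** The coefficient in [Xmid] at a vertex without pendant edges. *)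
Definition path_coef (q : R) : R := q + q^-1 - mu q.

(* The value at distance [k] from its end of an eigenfunction on a loose path. *)
Fixpoint arm (q : R) (k : nat) : R :=
  if k is k1.+1 then
    if k1 is k2.+1 then path_coef q * arm q k1 - arm q k2 else q
  else 1.

Definition arm_ratio (q : R) (k : nat) : R := arm q k / arm q k.+1.

Lemma armE q k : arm q k.+2 = path_coef q * arm q k.+1 - arm q k.
Proof. by []. Qed.

Lemma path_coef_ge q : 7 <= q -> q - 1 <= path_coef q.
Proof.
move=> q7; have muq := edge_gain_mulq M1 q7; have q0 : 0 < q by lra.
suff : mu q <= 1 + q^-1 by rewrite /path_coef; lra.
by rewrite -(ler_pM2r q0) mulrDl mulVf ?gt_eqF // mul1r.
Qed.

Lemma arm_gt0_lt q k : 7 <= q -> 0 < arm q k /\ arm q k < arm q k.+1.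
Proof.
move=> q7; elim: k => [|k [IH0 IH1]]; first by split=> /=; lra.
have IH2 := lt_trans IH0 IH1; split=> //.
by rewrite armE; have := path_coef_ge q7; nra.
Qed.

Lemma arm_gt0 q k : 7 <= q -> 0 < arm q k.
Proof. by move=> /arm_gt0_lt -/(_ k)[]. Qed.

Lemma arm_lt q k l : 7 <= q -> (k < l)%N -> arm q k < arm q l.
Proof.
move=> q7; elim: l => // l IHl; rewrite ltnS leq_eqVlt => /orP[/eqP->|kl].
  by have [] := arm_gt0_lt l q7.
by apply: lt_trans (IHl kl) _; have [] := arm_gt0_lt l q7.
Qed.

Lemma arm_ratio_lt1 q k : 7 <= q -> arm_ratio q k < 1.
Proof.
by move=> q7; rewrite ltr_pdivrMr ?arm_gt0 // mul1r arm_lt.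
Qed.

(** The Casorati determinant of the recurrence is constant, because [arm q k] enters with
    coefficient -1; its value is read off at [k = 0]. *)
Lemma arm_casorati q k : 7 <= q ->
  arm q k.+1 ^+ 2 - arm q k * arm q k.+2 = mu q * q.
Proof.
move=> q7; elim: k => [|k IHk].
  rewrite armE /= /path_coef; field; rewrite gt_eqF //; lra.
by rewrite -IHk !armE; ring.
Qed.

Lemma arm_ratio_step q k : 7 <= q ->
  arm_ratio q k.+1 - arm_ratio q k = mu q * q / (arm q k.+1 * arm q k.+2).
Proof.
move=> q7; rewrite -(arm_casorati k q7) /arm_ratio; field.
by rewrite !gt_eqF ?arm_gt0.
Qed.

Lemma arm_ratio_ltS q k : 7 <= q -> arm_ratio q k < arm_ratio q k.+1.
Proof.
move=> q7; rewrite -subr_gt0 arm_ratio_step //.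
have mu0 := edge_gain_gt0 M1 q7; have q0 : 0 < q by lra.
by rewrite divr_gt0 // mulr_gt0 ?arm_gt0.
Qed.

Lemma arm_ratio_lt q k l : 7 <= q -> (k < l)%N -> arm_ratio q k < arm_ratio q l.
Proof.
move=> q7; elim: l => // l IHl; rewrite ltnS leq_eqVlt => /orP[/eqP->|kl].
  exact: arm_ratio_ltS.
by apply: lt_trans (IHl kl) _; exact: arm_ratio_ltS.
Qed.

(** By [arm_ratio_step] the increments have a fixed numerator over products of arm values, which
    grow with the index. *)
Lemma arm_ratio_concave q k l : 7 <= q -> (k < l)%N ->
  arm_ratio q k + arm_ratio q l.+1 < arm_ratio q k.+1 + arm_ratio q l.
Proof.
move=> q7 kl.
suff : arm_ratio q l.+1 - arm_ratio q l < arm_ratio q k.+1 - arm_ratio q k by lra.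
rewrite !arm_ratio_step // ltr_pM2l; last first.
  by have mu0 := edge_gain_gt0 M1 q7; rewrite mulr_gt0 //; lra.
rewrite ltf_pV2 ?posrE ?mulr_gt0 ?arm_gt0 //.
by apply: ltr_pM; rewrite ?arm_lt // ltW // arm_gt0.
Qed.

(** The equation at a hub with [n] pendant edges and arms of lengths [a] and [b], divided by the
    value at the hub; each ratio is the value of the hub's neighbour on an arm relative to the
    hub. *)
Definition hub_defect (n : R) (a b : nat) (q : R) : R :=
  q + q^-1 - mu q * (n + 1) - (arm_ratio q a.-1 + arm_ratio q b.-1).

Lemma cvg_arm (q : R) k : 7 <= q -> (arm x k @[x --> q] --> arm q k)%classic.
Proof.
move=> q7; have cx : (x @[x --> q] --> q)%classic by exact: cvg_id.
have q0 : q != 0 by rewrite gt_eqF //; lra.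
have cc (r : R) : ((fun=> r : R) x @[x --> q] --> r)%classic by exact: cvg_cst.
have cK : (path_coef x @[x --> q] --> path_coef q)%classic.
  apply: cvgB; first by apply: cvgD => //; apply: cvgV.
  apply: cvgM; first by apply: cvgM => //; apply: cvgD.
  apply: cvgV; first by rewrite gt_eqF // mulr_gt0 //; move: M1; lra.
  by apply: cvgM => //; apply: cvgD.
(* The recurrence has order two, so two consecutive values are carried along. *)
have pair j : (arm x j @[x --> q] --> arm q j)%classic /\
              (arm x j.+1 @[x --> q] --> arm q j.+1)%classic.
  elim: j => [|j [IH0 IH1]]; first by split; [exact: cc|exact: cx].
  by split=> //; exact: cvgB (cvgM cK IH1) IH0.
by case: (pair k).
Qed.

Lemma cvg_hub_defect n a b (q : R) : 7 <= q ->
  (hub_defect n a b x @[x --> q] --> hub_defect n a b q)%classic.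
Proof.
move=> q7; have cx : (x @[x --> q] --> q)%classic by exact: cvg_id.
have q0 : q != 0 by rewrite gt_eqF //; lra.
have cc (r : R) : ((fun=> r : R) x @[x --> q] --> r)%classic by exact: cvg_cst.
have cr k : (arm_ratio x k @[x --> q] --> arm_ratio q k)%classic.
  by apply: cvgM; [exact: cvg_arm|apply: cvgV; rewrite ?gt_eqF ?arm_gt0 //; exact: cvg_arm].
apply: cvgB; last exact: cvgD.
apply: cvgB; first by apply: cvgD => //; apply: cvgV.
apply: cvgM => //; apply: cvgM; first by apply: cvgM => //; apply: cvgD.
apply: cvgV; first by rewrite gt_eqF // mulr_gt0 //; move: M1; lra.
by apply: cvgM => //; apply: cvgD.
Qed.

Lemma hub_defect_root n a b (q0 q1 : R) : 7 <= q0 -> q0 <= q1 ->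
  hub_defect n a b q0 < 0 -> 0 < hub_defect n a b q1 ->
  exists2 q, q0 < q < q1 & hub_defect n a b q = 0.
Proof.
move=> q7 q01 f0 f1.
have cf : ({within `[q0, q1], continuous (hub_defect n a b)})%classic.
  apply: continuous_in_subspaceT => x /set_mem xq.
  have : x \in `[q0, q1] by exact: xq.
  by rewrite in_itv /= => /andP[qx _]; apply: cvg_hub_defect; exact: le_trans qx.
have [|q] := @IVT R (hub_defect n a b) q0 q1 0 q01 cf.
  rewrite ge_min le_max (ltW f0) (ltW f1) orbT //.
rewrite in_itv /= => /andP[qq0 qq1] fq; exists q => //.
rewrite !lt_neqAle qq0 qq1 !andbT; apply/andP; split.
  by apply/eqP => qE; rewrite qE fq ltxx in f0.
by apply/eqP => qE; rewrite -qE fq ltxx in f1.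
Qed.

(** At this [q] the terms other than the ratios add up to [2 / q], while each ratio is at least
    [arm_ratio q 0 = q^-1], strictly on an arm of length at least two. *)
Lemma hub_defect_base n a b q : 7 <= q -> q * (q + M - 1) = (n + 2) * M ->
  (1 < b)%N -> hub_defect n a b q < 0.
Proof.
move=> q7 qE b1; rewrite /hub_defect (edge_gain_hub M1 q7 qE).
have r0 : arm_ratio q 0 = q^-1 by rewrite /arm_ratio /= div1r.
have rb : q^-1 < arm_ratio q b.-1 by rewrite -r0 arm_ratio_lt //; lia.
suff ra : q^-1 <= arm_ratio q a.-1 by lra.
by rewrite -r0; case: a.-1 => // k; rewrite ltW // arm_ratio_lt.
Qed.

(** The ratios are below 1 and the gain is at most [1 + q^-1 <= 3 / 2]. This supplies the upper end
    for the intermediate value theorem. *)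
Lemma hub_defect_large n a b q : 7 <= q -> 0 <= n -> 2 * n + 4 <= q ->
  0 < hub_defect n a b q.
Proof.
move=> q7 n0 nq; rewrite /hub_defect.
have ra := arm_ratio_lt1 a.-1 q7; have rb := arm_ratio_lt1 b.-1 q7.
have q0 : 0 < q by lra.
have muq : mu q * (n + 1) <= (1 + q^-1) * (n + 1).
  rewrite ler_wpM2r //; first lra.
  by rewrite -(ler_pM2r q0) mulrDl mulVf ?gt_eqF // mul1r edge_gain_mulq.
have qV : q^-1 <= 1 / 2 by rewrite -[q^-1]mul1r ler_pM2l // lef_pV2 ?qualifE /=; lra.
have qV0 : 0 < q^-1 by rewrite invr_gt0.
have : q^-1 * (n + 1) <= 1 / 2 * (n + 1) by rewrite ler_wpM2r //; lra.
by move: muq; rewrite mulrDl mul1r; lra.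
Qed.

(** By concavity, a step of the hub towards the middle raises the sum of the two ratios. *)
Lemma hub_defect_mono n a b q : 7 <= q -> (0 < a)%N -> (a.+1 < b)%N ->
  hub_defect n a.+1 b q < hub_defect n a b.+1 q.
Proof.
move=> q7 a0 ab; rewrite /hub_defect /= ltrD2l ltrN2.
case: a a0 ab => // a _ ab; case: b ab => // b ab /=.
by apply: arm_ratio_concave => //; lia.
Qed.

End Arms.

(** * Dependence of the spectral radius on the position of the hub *)

Section HubPosition.
Variables (R : realType) (m d n : nat).
Hypothesis m1 : (1 < m)%N.
Let M : R := m.-1%:R.
Let M1 : 1 <= M. Proof. by rewrite ler1n; lia. Qed.

Lemma lambda1_Td_single a q : (0 < a < d)%N -> 7 <= q ->
  hub_defect M n%:R a (d - a) q = 0 ->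
  lambda1 R m (Td_single m d a.+1 n) = (q + M - 1) / M.
Proof.
move=> /andP[a0 ad] q7 hub.
have M0 : 0 < M by move: M1; lra.
pose z := arm M q; have z0 k : 0 < z k by exact: arm_gt0.
(* Each arm is scaled by the hub value of the other one, so that they agree at index [a], the hub
   v_(a+1). *)
pose X j : R := if (j <= a)%N then z j * z (d - a)%N else z (d - j)%N * z a.
pose r j := if j == a then n else 0%N.
have Xge j : (a <= j)%N -> X j = z (d - j)%N * z a.
  by rewrite /X leq_eqVlt => /orP[/eqP<-|]; rewrite ?leqnn 1?mulrC // ltnNge => /negbTE->.
have Xle j : (j <= a)%N -> X j = z j * z (d - a)%N by rewrite /X => ->.
have zS k : z k + z k.+2 = path_coef M q * z k.+1 by rewrite /z armE; ring.
have := @lambda1_positive_eigenfunction R m (Td_single m d a.+1 n).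
move=> /(_ (@attach_value _ _ _ _ q X) ((q + M - 1) / M) (inl (inl ord0))).
apply=> //.
- by rewrite divr_ge0 ?(ltW M0) //; move: M1; lra.
- exact: linear_attach.
- apply: attach_value_gt0 => // j jd; rewrite /X; case: ifP => _; exact: mulr_gt0.
move=> u; rewrite [_ * ((q + M - 1) / M)](_ : _ = q + M - 1); last first.
  by rewrite mulrC -mulrA mulVf ?mulr1 // gt_eqF.
apply: (@attach_eigen _ _ _ m1 R q X r) => //.
- lia.
- move=> i; rewrite /r eqSS; case: ifP => // id; case: eqP => // ia.
  by move: id; rewrite ia; lia.
- by rewrite /r; case: eqP => //; lia.
- by rewrite /r; case: eqP => //; lia.
- by rewrite !Xle // mul1r.
- rewrite !Xge //; [|lia|lia]; rewrite subnn (_ : d - d.-1 = 1)%N; last lia.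
  by rewrite mul1r.
move=> j /andP[j0 jd]; rewrite /r; case: (ltngtP j a) => ja.
- rewrite mulr1 !Xle //; try lia.
  by rewrite -mulrDl -[j in X in _ = _ * X](prednK j0) -[j in z j.+1](prednK j0) zS mulrA.
- rewrite mulr1 !Xge //; try lia.
  rewrite -mulrDl (_ : d - j.-1 = (d - j.+1).+2)%N; last lia.
  by rewrite addrC zS (_ : (d - j.+1).+1 = d - j)%N ?mulrA //; lia.
rewrite ja Xle; last lia. rewrite Xge // Xge //.
have -> : q + q^-1 - edge_gain M q * n.+1%:R =
    z a.-1 / z a + z (d - a).-1 / z (d - a)%N.
  move: hub; rewrite /hub_defect /arm_ratio -/z !prednK //; last by rewrite subn_gt0.
  by rewrite -[n.+1%:R]natr1 => /eqP; rewrite subr_eq0 => /eqP.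
rewrite subnS; field; rewrite !gt_eqF //.
Qed.

(** At the root [q] found for the hub v_p, the defect of a hub nearer the end is positive, while at
    [q0] it is negative; so the latter hub has a root below [q], and [lambda1_Td_single] turns roots
    into spectral radii. *)
Lemma lambda1_hub_position p q0 :
  (1 < p)%N -> (p.*2 <= d)%N -> 7 <= q0 ->
  q0 * (q0 + M - 1) = (n%:R + 2) * M ->
  (q0 + M - 1) / M < lambda1 R m (Td_single m d p n) /\
  forall i, (1 < i < p)%N ->
    lambda1 R m (Td_single m d i n) < lambda1 R m (Td_single m d p n).
Proof.
move=> p1 pd q7 qE; have M0 : 0 < M by move: M1; lra.
(* The hub v_p is at distance [a = p - 1] from the end. *)
case: p p1 pd => // a a0 ad; rewrite ltnS in a0.
have := @hub_defect_root R M M1 n%:R a (d - a) q0 (q0 + (2 * n%:R + 4)) q7.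
have n0 : 0 <= n%:R :> R by exact: ler0n.
case; first lra.
- by apply: hub_defect_base => //; lia.
- by apply: hub_defect_large => //; lra.
move=> q /andP[q0q _] fq.
have q7' : 7 <= q by lra.
have lamp := @lambda1_Td_single a q _ q7' fq.
have {}lamp : lambda1 R m (Td_single m d a.+1 n) = (q + M - 1) / M by apply: lamp; lia.
rewrite lamp; split; first by rewrite ltr_pM2r ?invr_gt0 //; lra.
case=> // b /andP[b0 ba]; rewrite !ltnS in b0 ba.
have fb : 0 < hub_defect M n%:R b (d - b) q.
  pose f c := hub_defect M n%:R c (d - c) q.
  have step c : (0 < c < a)%N -> f c.+1 < f c.
    move=> ca; rewrite /f (_ : d - c = (d - c.+1).+1)%N; last lia.
    by apply: hub_defect_mono => //; lia.
  suff : forall k, (k.+1 < a)%N -> 0 < f (a - k.+1)%N.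
    by move=> /(_ (a - b).-1); rewrite (_ : a - (a - b).-1.+1 = b)%N; [apply; lia|lia].
  elim=> [|k IHk] ka.
    by rewrite -fq -/(f a) -[in X in X < _](subnK a0) addn1 step //; lia.
  apply: lt_trans (IHk _) _; first lia.
  by rewrite (_ : a - k.+1 = (a - k.+2).+1)%N; [apply: step; lia|lia].
have := @hub_defect_root R M M1 n%:R b (d - b) q0 q q7 (ltW q0q).
case=> //; first by apply: hub_defect_base => //; lia.
move=> q' /andP[q0q' q'q] fq'.
rewrite (@lambda1_Td_single b q') //; [|lia|lra].
by rewrite ltr_pM2r ?invr_gt0 //; lra.
Qed.

End HubPosition.

Local Open Scope nat_scope.

(** * Hypertrees with a large hub *)

Lemma isomorphic_sym (G H : hypergraph) : isomorphic G H -> isomorphic H G.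
Proof.
case=> f [g gK fK] fE; exists g; first by exists f.
move=> e; rewrite -fE -imset_comp.
suff -> : (f \o g) @: e = e by [].
by rewrite -[RHS]imset_id; apply: eq_imset => x /=; rewrite fK.
Qed.

Lemma nth_imset (T : finType) (x0 : T) (A : {set T}) k : #|A| = k ->
  [set nth x0 (enum A) b | b : 'I_k] = A.
Proof.
move=> Ak; apply/setP => x; apply/imsetP/idP => [[b _ ->]|xA].
  by rewrite -mem_enum mem_nth // -cardE Ak.
have xk : index x (enum A) < k by rewrite -Ak cardE index_mem mem_enum.
by exists (Ordinal xk); rewrite //= nth_index ?mem_enum.
Qed.

Section Hub.
Variables (T : hypergraph) (h : T).
Variables (top : {set T} -> T) (par : T -> {set T}) (dep : T -> nat).
Hypothesis ori : oriented h (edges T) top par dep.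
Variables (d n : nat) (v : 'I_d.+1 -> T) (e : 'I_d -> {set T}).
Hypothesis pth : is_path v e.
Hypothesis edgesK : #|edges T| = n + d.
Hypothesis hubn : n.+2 <= degree h.

Let P := [set e i | i : 'I_d].

Let cardP : #|P| = d.
Proof. by have [_ eI _] := pth; rewrite card_imset // card_ord. Qed.

Let PE : P \subset edges T.
Proof. by apply/subsetP => f /imsetP[i _ ->]; have [_ _ /(_ i)[]] := pth. Qed.

(** At most two child edges of [h] lie on the path and only [n] edges lie off it, so degree [n + 2]
    forces both counts to be attained. Two path edges with top [h] then place [h] inside the
    path. *)
Lemma hub_on_path : exists i : 'I_d.+1, [/\ 0 < i < d, v i = h &
  forall f, f \in edges T -> f \notin P -> h \in f].
Proof.
set A := child_edges top h.
have hA : n.+2 <= #|A| by rewrite -(degree_root ori).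
have AP2 : #|A :&: P| <= 2.
  apply: leq_trans (path_depth_card ori 0 pth); apply/subset_leq_card/subsetP => f.
  by rewrite !inE => /andP[/andP[_ /eqP->] ->]; rewrite (dep_root ori) eqxx.
have EP : #|edges T :\: P| = n.
  by have := cardsID P (edges T); rewrite (setIidPr PE) cardP edgesK addnC => /addIn.
have sub : A :\: P \subset edges T :\: P.
  by apply: setSD; apply/subsetP => f; rewrite inE => /andP[].
have AD := subset_leq_card sub.
have AID := cardsID P A; rewrite EP in AD.
have [x xE] : exists x, x = #|A :&: P| by eexists.
have [y yE] : exists y, y = #|A :\: P| by eexists.
rewrite -xE -yE in AP2 AID AD.
have ny : n <= y by rewrite -(leq_add2l x) AID (leq_trans _ hA) // -addn2 addnC leq_add2l.
have x1 : 1 < x by rewrite -(leq_add2r y) AID (leq_trans _ hA).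
have AE : A :\: P = edges T :\: P by apply/eqP; rewrite eqEcard sub EP -yE.
rewrite xE in x1.
have [f [g [fA gA fg]]] := card_gt1P x1.
case/setIP: fA gA fg => fA /imsetP[i _ fi] /setIP[gA /imsetP[j _ gj]].
move=> fg; rewrite fi in fA fg; rewrite gj in gA fg => {f g fi gj}.
have out f : f \in edges T -> f \notin P -> h \in f.
  move=> fE fP; have : f \in A :\: P by rewrite AE inE fP.
  by rewrite !inE => /and3P[_ _ /eqP<-]; exact: (top_in ori).
wlog ij : i j fA gA fg / i < j.
  move=> W; case: (ltngtP i j) => [ij|ij|/val_inj ij].
  - exact: W ij.
  - by apply: (W j i) => //; rewrite eq_sym.
  - by rewrite ij eqxx in fg.
move: fA gA; rewrite !inE => /andP[_ /eqP ti] /andP[_ /eqP tj].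
(* A descending step [i] would make the top of [e j] deeper than that of [e i], but both tops are
   [h]. *)
have : ~~ descending top v e i.
  apply/negP => /(path_descend ori pth ij)[_].
  by rewrite ti tj ltnn.
rewrite negbK => /eqP vi; exists (lift ord0 i); split=> //; last by rewrite vi.
by rewrite /= /bump /= add1n (leq_ltn_trans ij).
Qed.

End Hub.

(** * The isomorphism with [T_d] *)

Section HubIso.
Variables (T : hypergraph) (h : T) (m d n : nat).
Hypothesis m1 : 1 < m.
Hypothesis uni : uniform T m.
Hypothesis conn : connected_hypergraph T.
Hypothesis cardT : #|T| = 1 + #|edges T| * m.-1.
Variables (v : 'I_d.+1 -> T) (e : 'I_d -> {set T}) (i0 : 'I_d.+1).
Hypothesis pth : is_path v e.
Hypothesis vi0 : v i0 = h.
Hypothesis edgesK : #|edges T| = n + d.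
Let P := [set e i | i : 'I_d].
Hypothesis out : forall f, f \in edges T -> f \notin P -> h \in f.
Variable cf : loose_path m d -> nat.
Hypothesis cfl : forall i : 'I_d.+1, cf (inl i) = if i == i0 then n else 0.
Hypothesis cfr : forall x, cf (inr x) = 0.
Let G := @attach_pendant_edges m (loose_path m d) cf.

Definition off_path : {set {set T}} := edges T :\: P.

Definition hub_edge_image (k : nat) : {set T} := nth set0 (enum off_path) k.

Definition path_rest (j : 'I_d) : {set T} :=
  e j :\: [set v (widen_ord (leqnSn d) j); v (lift ord0 j)].

(** All pendant edges sit at one hub, so the index [tagged s] alone selects an edge off the path.
    The remaining vertices of corresponding edges are matched in order of enumeration, and the
    default [h] is never reached. *)
Definition hub_map (x : G) : T :=
  match x with
  | inl (inl i) => v i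
  | inl (inr (j, b)) => nth h (enum (path_rest j)) b
  | inr (s, b) => nth h (enum (hub_edge_image (tagged s) :\ h)) b
  end.

Lemma card_off_path : #|off_path| = n.
Proof.
have [_ eI ve] := pth.
have PE : P \subset edges T.
  by apply/subsetP => f /imsetP[i _ ->]; have [] := ve i.
have := cardsID P (edges T); rewrite (setIidPr PE) edgesK.
by rewrite card_imset // card_ord addnC => /addIn.
Qed.

Lemma hub_edge_imageP k : k < n -> [/\ hub_edge_image k \in edges T,
  hub_edge_image k \notin P & h \in hub_edge_image k].
Proof.
move=> kn; have : hub_edge_image k \in off_path.
  by rewrite -mem_enum mem_nth // -cardE card_off_path.
by rewrite inE => /andP[kP kE]; split=> //; exact: out.
Qed.

Lemma tag_hub (s : attach_index cf) : tag s = inl i0.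
Proof.
case: s => [[i|x] k] /=; last by case: k; rewrite cfr.
by case: k; rewrite cfl; case: eqP => // ->.
Qed.

Lemma tagged_lt (s : attach_index cf) : tagged s < n.
Proof. by have := ltn_ord (tagged s); rewrite {2}tag_hub cfl eqxx. Qed.

Lemma hub_map_path_edge j : hub_map @: path_edge cf j = e j.
Proof.
have [vI _ /(_ j)[jE a b]] := pth.
rewrite /path_edge -imset_comp /loose_path_edge imsetU imsetU1 imset_set1 /=.
rewrite -imset_comp /=.
rewrite (_ : _ @: 'I_(m - 2) = path_rest j); last first.
  apply: (nth_imset h); rewrite /path_rest cardsDS.
    rewrite (uni jE) cards2 (inj_eq vI) (_ : _ != _) //.
    by rewrite -val_eqE /= /bump /=; lia.
  by apply/subsetP => x; rewrite !inE => /orP[] /eqP->.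
rewrite /path_rest -{2}(setID (e j) [set v (widen_ord (leqnSn d) j); v (lift ord0 j)]).
congr (_ :|: _); apply/esym/setIidPr.
by apply/subsetP => x; rewrite !inE => /orP[] /eqP->.
Qed.

Lemma hub_map_hub_edge (s : attach_index cf) :
  hub_map @: hub_edge s = hub_edge_image (tagged s).
Proof.
have [kE _ hk] := hub_edge_imageP (tagged_lt s).
rewrite /hub_edge /attached_edge imsetU1 -imset_comp.
rewrite {1}tag_hub /= vi0 (_ : _ @: 'I_(m - 1) = hub_edge_image (tagged s) :\ h).
  by rewrite setD1K.
apply: (nth_imset h); have := uni kE; rewrite (cardsD1 h) hk; lia.
Qed.

Lemma edge_hub_map f : f \in edges T -> exists2 x, x \in edges G & hub_map @: x = f.
Proof.
move=> fE; case: (boolP (f \in P)) => [/imsetP[j _ ->]|fP].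
  exists (path_edge cf j); last exact: hub_map_path_edge.
  by rewrite edges_attach inE imset_f.
have fo : f \in off_path by rewrite inE fP.
have kn : index f (enum off_path) < cf (inl i0).
  by rewrite cfl eqxx -card_off_path cardE index_mem mem_enum.
exists (hub_edge (Tagged (fun x => 'I_(cf x)) (Ordinal kn))).
  by rewrite edges_attach inE [X in _ || X]imset_f ?orbT.
by rewrite hub_map_hub_edge /hub_edge_image /= nth_index ?mem_enum.
Qed.

Lemma card_attach_index : #|{: attach_index cf}| = n.
Proof.
rewrite -sum1_card.
rewrite -(@sig_big_dep _ _ _ _ _ xpredT (fun=> xpredT) (fun _ _ => 1)) /=.
rewrite (bigD1 (inl i0)) //= sum1_card card_ord cfl eqxx big1 ?addn0 //.
move=> x xi; rewrite sum1_card card_ord; case: x xi => [i|x] xi; rewrite ?cfr //.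
by rewrite cfl ifN //; apply: contra xi => /eqP->.
Qed.

(* [hub_map] is onto because its image contains all edges, and both hypergraphs
   have [1 + (n + d) (m - 1)] vertices. *)
Lemma hub_isomorphic : 0 < d -> isomorphic T G.
Proof.
move=> d0; apply: isomorphic_sym.
have surj u : u \in hub_map @: [set: G].
  have [w uw] : exists w, u != w.
    have /card_gt1P[x [y [_ _ xy]]] : 1 < #|T|.
      by rewrite cardT edgesK; nia.
    by case: (eqVneq u x) => [->|ux]; [exists y|exists x].
  have [f fE uf] := exists_edge conn uw.
  have [x xE xf] := edge_hub_map fE.
  by move: uf; rewrite -xf => /imsetP[y _ ->]; rewrite imset_f.
have surjE : hub_map @: [set: G] = [set: T].
  by apply/setP => u; rewrite surj inE.
have inj : injective hub_map.
  suff /imset_injP inj : #|hub_map @: [set: G]| == #|[set: G]|.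
    by move=> x y; apply: inj; rewrite inE.
  rewrite surjE !cardsT cardT edgesK /=.
  rewrite card_sum card_sum !card_prod !card_ord card_attach_index.
  by apply/eqP; nia.
have Gto x : x \in edges G -> hub_map @: x \in edges T.
  rewrite edges_attach => /setUP[] /imsetP[j _ ->].
    by rewrite hub_map_path_edge; have [_ _ /(_ j)[]] := pth.
  by rewrite hub_map_hub_edge; have [] := hub_edge_imageP (tagged_lt j).
exists hub_map.
  apply: inj_card_bij => //.
  by have := leq_imset_card hub_map [set: G]; rewrite surjE !cardsT.
move=> x; apply/idP/idP => [/edge_hub_map[y yE yx]|/Gto//].
by rewrite -(imset_inj inj yx).
Qed.

End HubIso.

(** * The root of the star equation and the combination of the two cases *)

Local Open Scope ring_scope.

Lemma exists_star_root (R : realType) (M n : R) :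
  1 <= M -> 42 <= (n - 6) * M ->
  exists2 q, 7 <= q & q * (q + M - 1) = (n + 2) * M.
Proof.
move=> M1 nM.
(* [D] is the discriminant. The positive root is at least 7 when [Num.sqrt D >= M + 13], which
   amounts to [(n - 5) * M >= 42]. *)
pose D := (M - 1) ^+ 2 + 4 * ((n + 2) * M).
have D13 : (M + 13) ^+ 2 <= D by rewrite /D; nra.
have D0 : 0 <= D by apply: le_trans D13; exact: sqr_ge0.
exists ((Num.sqrt D - (M - 1)) / 2).
  have : M + 13 <= Num.sqrt D.
    by rewrite -[M + 13]gtr0_norm; [rewrite -sqrtr_sqr ler_sqrt|lra].
  by lra.
have := sqr_sqrtr D0; set s := Num.sqrt D; rewrite /D => sE.
have -> : (s - (M - 1)) / 2 * ((s - (M - 1)) / 2 + M - 1) =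
  (s ^+ 2 - (M - 1) ^+ 2) / 4 by field.
by rewrite sE; field.
Qed.

Lemma degree_interior (T : hypergraph) d (v : 'I_d.+1 -> T) (e : 'I_d -> {set T}) :
  is_path v e -> (1 < d)%N -> exists u : T, (1 < degree u)%N.
Proof.
case=> _ eI ve d1; have d0 : (0 < d)%N by exact: ltnW.
exists (v (lift ord0 (Ordinal d0))).
apply/card_gt1P; exists (e (Ordinal d0)), (e (Ordinal d1)); split.
- by have [? _ ?] := ve (Ordinal d0); rewrite inE; apply/andP.
- have [? ? _] := ve (Ordinal d1); rewrite inE; apply/andP; split=> //.
  by rewrite (_ : lift _ _ = widen_ord (leqnSn d) (Ordinal d1)) //; exact: val_inj.
- by apply/eqP => /eI /(congr1 val).
Qed.

Lemma hub_isomorphic_Td (T : hypergraph) (h : T) m d n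
    (v : 'I_d.+1 -> T) (e : 'I_d -> {set T}) (i : 'I_d.+1) :
  (1 < m)%N -> uniform T m -> connected_hypergraph T ->
  #|T| = (1 + #|edges T| * m.-1)%N -> is_path v e -> v i = h ->
  #|edges T| = (n + d)%N ->
  (forall f, f \in edges T -> f \notin [set e i | i : 'I_d] -> h \in f) ->
  (0 < i < d)%N -> isomorphic T (Td_single m d i.+1 n).
Proof.
move=> m1 uni conn cardT pth vi edgesK out id.
apply: (hub_isomorphic m1 uni conn cardT pth vi edgesK out) => //; last lia.
move=> j; rewrite eqSS val_eqE; case: eqP => [->|]; last by case: ifP.
by rewrite ifT //; lia.
Qed.

Lemma imset_rev_ord d (T : finType) (e : 'I_d -> T) :
  [set (e \o @rev_ord d) i | i : 'I_d] = [set e i | i : 'I_d].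
Proof.
apply/setP => x; apply/imsetP/imsetP => -[i _ ->]; exists (rev_ord i) => //=.
by rewrite rev_ordK.
Qed.

Theorem theorem2p2p1 (R : realType) (m k d : nat) (T : hypergraph) :
  (2 <= m)%N -> uniform T m -> hypertree T ->
  #|edges T| = k -> diameter_is T d ->
  (42 <= (k - d - 6) * (m - 1))%N ->
  let p := (d %/ 2)%N in
  (2 <= p)%N ->
  ~ isomorphic T (Td_single m d p.+1 (k - d)) ->
  lambda1 R m T <= lambda1 R m (Td_single m d p (k - d)) /\
  (lambda1 R m T = lambda1 R m (Td_single m d p (k - d)) ->
   isomorphic T (Td_single m d p (k - d))).
Proof.
move=> m1 uni [conn lin acyc two] edgesK [[x0 [y0 [[v [e [vI eI _ _ ve]]] _]]] _].
move=> km p p1 notTd; have pth : is_path v e by split.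
set n := (k - d)%N in km notTd *.
(* Subtraction is truncated, so [n <= 6] would make the product in [km] zero. It follows that
   [d < k], hence [k = n + d]. *)
have n6 : (6 < n)%N by case: (ltnP 6 n) => // n6; move: km; rewrite (eqnP n6).
have nd : #|edges T| = (n + d)%N by rewrite edgesK /n; lia.
have d3 : (3 < d)%N by rewrite /p in p1; lia.
have [u0 u02] := degree_interior pth (ltnW (ltnW d3)).
have [h _ hmaxT] := @arg_maxnP _ u0 xpredT (@degree T) isT.
have hmax (u : T) : (degree u <= degree h)%N by have := hmaxT u isT.
have h2 : (1 < degree h)%N := leq_trans u02 (hmax u0).
have [top [par [dep ori]]] := exists_oriented h conn lin acyc.
pose M : R := m.-1%:R.
have M1 : 1 <= M by rewrite ler1n; lia.
have nM : 42 <= (n%:R - 6) * M.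
  by rewrite -(natrB _ (ltnW n6)) -natrM ler_nat -subn1.
have [q q7 qE] := exists_star_root M1 nM.
have [lt_star lt_pos] := @lambda1_hub_position R m d n m1 p q p1 ltac:(rewrite /p; lia) q7 qE.
have conclude : lambda1 R m T < lambda1 R m (Td_single m d p n) ->
    lambda1 R m T <= lambda1 R m (Td_single m d p n) /\
    (lambda1 R m T = lambda1 R m (Td_single m d p n) ->
     isomorphic T (Td_single m d p n)).
  by move=> lt; split=> [|E]; [exact: ltW|rewrite E ltxx in lt].
pose P := [set e i | i : 'I_d].
have PE : P \subset edges T.
  by apply/subsetP => f /imsetP[i _ ->]; have [] := ve i.
(* Without a vertex of degree [n.+2], the star value separates the two spectral radii. *)
have [hn|hn] := leqP (degree h) n.+1.
  apply/conclude/(le_lt_trans _ lt_star).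
  apply: (@lambda1_no_hub R m n T h top par dep ori conn m1 uni two q q7 qE P) => //.
    by move=> j; exact: (path_depth_card ori j pth).
  have := cardsID P (edges T); rewrite (setIidPr PE) nd /P card_imset // card_ord.
  by rewrite addnC => /addIn.
have cardT := card_oriented ori conn uni.
have [i [id vi out]] := hub_on_path ori pth nd hn.
(* A hub beyond the middle is brought to the first half by reversing the path, which turns index [i]
   into [d - i]. *)
have [j [jd jp Tj]] : exists j, [/\ (0 < j < d)%N, (j <= p)%N &
    isomorphic T (Td_single m d j.+1 n)].
  have [ip|pi] := leqP i p.
    by exists i; split=> //; exact: (hub_isomorphic_Td m1 uni conn cardT pth vi nd out id).
  exists (rev_ord i); split.
  - by rewrite /=; lia.
  - by move: pi; rewrite /p /=; have := ltn_ord i; lia.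
  apply: (hub_isomorphic_Td (v := v \o @rev_ord d.+1) (e := e \o @rev_ord d) (h := h)) => //.
  - exact: is_path_rev.
  - by rewrite /= rev_ordK.
  - by rewrite imset_rev_ord.
  - by rewrite /=; lia.
(* Index [j] is the hub v_(j+1): [j = p] is the excluded hypertree, [j.+1 = p] the extremal one, and
   otherwise the hub is nearer the end. *)
have [jp'|jp'] := eqVneq j p; first by rewrite jp' in Tj.
have [jE|jE] := eqVneq j.+1 p.
  by rewrite -jE (lambda1_isomorphic R m Tj).
apply: conclude; rewrite (lambda1_isomorphic R m Tj); apply: lt_pos; lia.
Qed.
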